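(* Let $\mathfrak{U}$ be any family of finite-dimensional unitary groups equipped with bi-invariant submultiplicative norms. Every countable group embeds into a $3$-generated group which is uniformly $\mathfrak{U}$-stable, with a linear estimate.
   Context: **Stability.** All groups are discrete and countable; $\omega$ is a fixed non-principal ultrafilter on $\mathbb{N}=\{0,1,2,\dots\}$. $\mathfrak{U}$ is a family of pairs $(U(k),\|\cdot\|)$, where $U(k)$ is the group of $k\times k$ unitary matrices and $\|\cdot\|$ is a norm on $k\times k$ complex matrices that is submultiplicative ($\|AB\|\le\|A\|\|B\|$) and bi-invariant ($\|uAv\|=\|A\|$ for $u,v\in U(k)$); the same $U(k)$ may occur several times with different norms. For a group $G$ and maps $\phi,\psi:G\to U(k)$ put $\operatorname{def}(\phi)=\sup_{g,h\in G}\|\phi(gh)-\phi(g)\phi(h)\|$ and $\operatorname{dist}(\phi,\psi)=\sup_{g\in G}\|\phi(g)-\psi(g)\|$. A *uniform asymptotic homomorphism* $\phi:G\to\mathfrak{U}$ is a sequence of maps $\phi_n:G\to U(k_n)$, with $(U(k_n),\|\cdot\|)\in\mathfrak{U}$, such that $\operatorname{def}(\phi_n)\to 0$. $G$ is *uniformly $\mathfrak{U}$-stable* if for every uniform asymptotic homomorphism $(\phi_n)$ there are homomorphisms $\psi_n:G\to U(k_n)$ with $\operatorname{dist}(\phi_n,\psi_n)\to 0$. It is *uniformly $\mathfrak{U}$-stable with a linear estimate* if for every uniform asymptotic homomorphism $(\phi_n)$ there are homomorphisms $\psi_n:G\to U(k_n)$ with $\operatorname{dist}(\phi_n,\psi_n)=O_\omega(\operatorname{def}(\phi_n))$,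 i.e. there are $C\ge 0$ and $S\in\omega$ such that $\operatorname{dist}(\phi_n,\psi_n)\le C\operatorname{def}(\phi_n)$ for all $n\in S$. *)

(* Defs.v *)
From HB Require Import structures.
From mathcomp Require Import all_boot all_order all_algebra.
From mathcomp Require Import spectral complex.
From mathcomp Require Import all_classical all_reals all_analysis.

Set Implicit Arguments.
Unset Strict Implicit.
Unset Printing Implicit Defensive.

Import Order.TTheory GRing.Theory Num.Theory.
Import numFieldNormedType.Exports.
Import ComplexField.Normc.

Local Open Scope classical_set_scope.
Local Open Scope ring_scope.

Definition unitary (R : realType) (k : nat) : Type :=
  {A : 'M[R[i]]_k | A \is unitarymx}.

Section UnitaryGroup.
Variables (R : realType) (k : nat).
Implicit Types A B : unitary R k.

Fact unitary_one_subproof : (1%:M : 'M[R[i]]_k) \is unitarymx.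
Proof. by apply/unitarymxP; rewrite trmx1 map_mx1 mulmx1. Qed.

Fact unitary_inv_subproof A : map_mx Num.conj (val A)^T \is unitarymx.
Proof. by rewrite trmxC_unitary; exact: (valP A). Qed.

Definition unitary_one : unitary R k :=
  exist _ 1%:M unitary_one_subproof.

Definition unitary_mul A B : unitary R k :=
  exist _ (val A *m val B) (mul_unitarymx (valP A) (valP B)).

Definition unitary_inv A : unitary R k :=
  exist _ (map_mx Num.conj (val A)^T) (unitary_inv_subproof A).

Fact unitary_mulA : associative unitary_mul.
Proof. by move=> A B D; apply: val_inj; rewrite /= mulmxA. Qed.

Fact unitary_mul1 : left_id unitary_one unitary_mul.
Proof. by move=> A; apply: val_inj; rewrite /= mul1mx. Qed.

Fact unitary_mulr1 : right_id unitary_one unitary_mul.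
Proof. by move=> A; apply: val_inj; rewrite /= mulmx1. Qed.

Fact unitary_mulrV : right_inverse unitary_one unitary_inv unitary_mul.
Proof. by move=> A; apply: val_inj; exact/unitarymxP/(valP A). Qed.

Fact unitary_mulV : left_inverse unitary_one unitary_inv unitary_mul.
Proof.
by move=> A; apply: val_inj; apply: mulmx1C; exact/unitarymxP/(valP A).
Qed.

HB.instance Definition _ := Choice.on (unitary R k).
HB.instance Definition _ := isGroup.Build (unitary R k)
  unitary_mulA unitary_mul1 unitary_mulr1 unitary_mulV unitary_mulrV.

End UnitaryGroup.

(* A pair (U(k), ||.||).  Nonnegativity of the norm follows from the triangle
   inequality and homogeneity. *)
Record normed_unitary (R : realType) := NormedUnitary {
  udim : nat;
  unorm : 'M[R[i]]_udim -> R;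
  unormD : forall A B, unorm (A + B) <= unorm A + unorm B;
  unormZ : forall (z : R[i]) A, unorm (z *: A) = normc z * unorm A;
  unorm_eq0 : forall A, unorm A = 0 -> A = 0;
  unormM : forall A B, unorm (A *m B) <= unorm A * unorm B;
  unorm_bi : forall u A v, u \is unitarymx -> v \is unitarymx ->
    unorm (u *m A *m v) = unorm A }.

Section Stability.
Variables (R : realType) (G : groupType).

(* By bi-invariance every unitary matrix has norm unorm 1%:M, so the sets
   below are nonempty and bounded by 2 * unorm 1%:M: both [sup] are genuine. *)
Definition defect (U : normed_unitary R) (phi : G -> unitary R (udim U)) : R :=
  sup [set unorm (val (phi (g * h)%g) - val (phi g) *m val (phi h))
      | g in [set: G] & h in [set: G]].

Definition udist (U : normed_unitary R)
    (phi psi : G -> unitary R (udim U)) : R :=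
  sup [set unorm (val (phi g) - val (psi g)) | g in [set: G]].

Definition uniform_asymptotic_hom (UU : set (normed_unitary R))
    (U : nat -> normed_unitary R)
    (phi : forall n, G -> unitary R (udim (U n))) : Prop :=
  (forall n, UU (U n)) /\ defect (phi n) @[n --> \oo] --> (0 : R).

Definition uniformly_stable_linear (omega : set_system nat)
    (UU : set (normed_unitary R)) : Prop :=
  forall (U : nat -> normed_unitary R)
         (phi : forall n, G -> unitary R (udim (U n))),
    uniform_asymptotic_hom UU phi ->
    exists psi : forall n, {multiplicative G -> unitary R (udim (U n))},
    exists2 C : R, 0 <= C &
    exists2 S : set nat, omega S &
      forall n, S n -> udist (phi n) (psi n) <= C * defect (phi n).

End Stability.

(* The generators are not required to be distinct. *)
Definition n_generated (n : nat) (G : groupType) : Prop :=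
  exists s : n.-tuple G, forall H : {pred G},
    group_closed H -> {subset s <= H} -> H =i predT.

Definition embeds (Gamma G : groupType) : Prop :=
  exists f : {multiplicative Gamma -> G}, injective f.

Definition nonprincipal (T : Type) (F : set_system T) : Prop :=
  forall x : T, F <> principal_filter x.

(* Main.v *)
(** Let K be a countable group containing Gamma in which every element is a
    commutator; it is found inside a union of permutation groups, where an
    element is a commutator by an infinite swindle.  Let G be generated by the
    shift t of Z and by h, an element of the unrestricted product of copies of K
    indexed by Z that has the i-th element of K at position 2^i and is trivial
    elsewhere.  Distinct translates of h meet in at most one position, so the
    commutators of these translates generate the restricted product N of the
    copies of K; hence G contains Gamma, and G / N is metabelian.

    Let phi be an eps-homomorphism of G.  If x and y are in N, then t^n x t^-n
    commutes with y for all large n, and by compactness of U(k) some large n has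
    phi(t^n) close to 1, up to O(eps).  Hence phi x and phi y almost commute, and
    phi is within 13 eps of 1 on the commutators [x, y], that is on all of N.
    So phi is close to a map that is constant on the cosets of N, and since
    G / N is amenable, Kazhdan's averaging argument applies: replacing phi g by
    the mean over x of phi(g x) phi(x)^*, made unitary by a Cayley transform,
    squares the defect up to a constant.  Iterating converges to a homomorphism
    at distance O(eps).  All constants are independent of the dimension and of
    the norm. *)

Require Import Defs.
From HB Require Import structures.
From mathcomp Require Import all_boot all_order all_algebra.
From mathcomp Require Import spectral complex.
From mathcomp Require Import all_classical all_reals all_analysis.
From mathcomp Require Import ring lra.
From mathcomp Require Import zify.

Set Implicit Arguments.
Unset Strict Implicit.
Unset Printing Implicit Defensive.

Import Order.TTheory GRing.Theory Num.Theory.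
Import numFieldNormedType.Exports.
Import ComplexField.Normc.

Local Open Scope classical_set_scope.
Local Open Scope ring_scope.

(** * Norms and limits along the ultrafilter *)

Definition adjmx (R : realType) (m n : nat) (A : 'M[R[i]]_(m, n)) :=
  map_mx Num.conj A^T.

Section Adjoint.
Variable R : realType.
Local Notation C := R[i].

Lemma adjmxM m n p (A : 'M[C]_(m, n)) (B : 'M[C]_(n, p)) :
  adjmx (A *m B) = adjmx B *m adjmx A.
Proof. by rewrite /adjmx trmx_mul map_mxM. Qed.

Lemma adjmxD m n (A B : 'M[C]_(m, n)) : adjmx (A + B) = adjmx A + adjmx B.
Proof. by rewrite /adjmx linearD map_mxD. Qed.

Lemma adjmxN m n (A : 'M[C]_(m, n)) : adjmx (- A) = - adjmx A.
Proof. by rewrite /adjmx linearN map_mxN. Qed.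

Lemma adjmxB m n (A B : 'M[C]_(m, n)) : adjmx (A - B) = adjmx A - adjmx B.
Proof. by rewrite adjmxD adjmxN. Qed.

Lemma adjmxZ m n (c : C) (A : 'M[C]_(m, n)) : adjmx (c *: A) = c^* *: adjmx A.
Proof. by rewrite /adjmx linearZ map_mxZ. Qed.

Lemma adjmx1 n : adjmx (1%:M : 'M[C]_n) = 1%:M.
Proof. by rewrite /adjmx trmx1 map_mx1. Qed.

Lemma adjmxK m n (A : 'M[C]_(m, n)) : adjmx (adjmx A) = A.
Proof. by apply/matrixP => i j; rewrite !mxE conjCK. Qed.

Lemma adj_unitary n (u : 'M[C]_n) : u \is unitarymx -> adjmx u \is unitarymx.
Proof. by rewrite trmxC_unitary. Qed.

Lemma mul_unitary_adj n (u : 'M[C]_n) : u \is unitarymx -> u *m adjmx u = 1%:M.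
Proof. by move/unitarymxP. Qed.

Lemma mul_adj_unitary n (u : 'M[C]_n) : u \is unitarymx -> adjmx u *m u = 1%:M.
Proof. by move/mul_unitary_adj/mulmx1C. Qed.

Lemma unitary_adjP n (u : 'M[C]_n) : u *m adjmx u = 1%:M -> u \is unitarymx.
Proof. by move/unitarymxP. Qed.

Lemma unitary1 n : (1%:M : 'M[C]_n) \is unitarymx.
Proof. by apply: unitary_adjP; rewrite adjmx1 mulmx1. Qed.

End Adjoint.

Section NormBasics.
Variables (R : realType) (U : normed_unitary R).
Local Notation C := R[i].
Local Notation k := (udim U).
Local Notation nu := (@unorm R U).
Implicit Types A B u v : 'M[C]_k.

Lemma nu0 : nu 0 = 0.
Proof. by rewrite -(scale0r (0 : 'M[C]_k)) unormZ normc0 mul0r. Qed.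

Lemma nuN A : nu (- A) = nu A.
Proof. by rewrite -scaleN1r unormZ normcN normc1 mul1r. Qed.

Lemma nu_ge0 A : 0 <= nu A.
Proof. by have := unormD A (- A); rewrite subrr nu0 nuN; lra. Qed.

Lemma nuB A B : nu (A - B) <= nu A + nu B.
Proof. by rewrite -(nuN B); exact: unormD. Qed.

Lemma nu_distC A B : nu (A - B) = nu (B - A).
Proof. by rewrite -nuN opprB. Qed.

Lemma nu_tri B A D : nu (A - D) <= nu (A - B) + nu (B - D).
Proof. by rewrite -[A - D](subrKA B) unormD. Qed.

Lemma nu_trans B A D a b :
  nu (A - B) <= a -> nu (B - D) <= b -> nu (A - D) <= a + b.
Proof. by move=> AB BD; apply: (le_trans (nu_tri B A D)); rewrite lerD. Qed.

Lemma nu_sym A B a : nu (A - B) <= a -> nu (B - A) <= a.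
Proof. by rewrite nu_distC. Qed.

Lemma nuUl u A : u \is unitarymx -> nu (u *m A) = nu A.
Proof.
move=> uU; have := @unorm_bi R U u A 1%:M uU (unitary1 R k).
by rewrite mulmx1.
Qed.

Lemma nuUr A v : v \is unitarymx -> nu (A *m v) = nu A.
Proof.
move=> vU; have := @unorm_bi R U 1%:M A v (unitary1 R k) vU.
by rewrite mul1mx.
Qed.

Lemma nuU u : u \is unitarymx -> nu u = nu 1%:M.
Proof. by move=> uU; rewrite -[u]mulmx1 nuUl. Qed.

Lemma nu_sum (I : Type) (r : seq I) (P : pred I) (F : I -> 'M[C]_k) :
  nu (\sum_(i <- r | P i) F i) <= \sum_(i <- r | P i) nu (F i).
Proof.
elim/big_rec2: _ => [|i y x Pi le_xy]; first by rewrite nu0.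
by apply: (le_trans (unormD _ _)); rewrite lerD2l.
Qed.

Lemma nu_eq0 A : nu A <= 0 -> A = 0.
Proof.
by move=> A0; apply: (@unorm_eq0 R U); apply/eqP; rewrite eq_le A0 nu_ge0.
Qed.

Lemma nu_eps0 A : (forall e : R, 0 < e -> nu A <= e) -> A = 0.
Proof.
by move=> Ae; apply: nu_eq0; apply/ler_addgt0Pr => e /Ae; rewrite add0r.
Qed.

Lemma nu_half A : nu (2^-1 *: A) = nu A / 2.
Proof.
rewrite unormZ mulrC; congr (_ * _).
rewrite normcV; congr (_^-1).
by rewrite -[2]/(1 *+ 2) normcMn normc1.
Qed.

Lemma nu_le_entries A :
  nu A <= \sum_i \sum_j normc (A i j) * nu (delta_mx i j).
Proof.
rewrite {1}[A]matrix_sum_delta.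
apply: (le_trans (nu_sum _ _ _)); apply: ler_sum => i _.
apply: (le_trans (nu_sum _ _ _)); apply: ler_sum => j _.
by rewrite unormZ.
Qed.

Lemma nu_delta_gt0 i j : 0 < nu (delta_mx i j).
Proof.
rewrite lt_neqAle nu_ge0 andbT eq_sym; apply/eqP => /(@unorm_eq0 R U)/matrixP.
by move=> /(_ i j)/eqP; rewrite !mxE !eqxx oner_eq0.
Qed.

(* [E_ii A E_jj = a_ij E_ij], so submultiplicativity bounds the entries. *)
Lemma entry_le_nu i j : exists2 c, 0 <= c & forall A, normc (A i j) <= c * nu A.
Proof.
exists (nu (delta_mx i i) * nu (delta_mx j j) / nu (delta_mx i j)).
  by rewrite divr_ge0 ?mulr_ge0 ?nu_ge0.
move=> A; rewrite mulrAC ler_pdivlMr ?nu_delta_gt0 // -unormZ.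
have -> : A i j *: delta_mx i j = delta_mx i i *m A *m delta_mx j j.
  apply/matrixP => a b; rewrite !mxE.
  rewrite (bigD1 j) //= big1 ?addr0 => [|c cj]; last first.
    by rewrite !mxE (negbTE cj) mulr0.
  rewrite !mxE (bigD1 i) //= big1 ?addr0 => [|c ci]; last first.
    by rewrite !mxE (negbTE ci) andbF mul0r.
  rewrite !mxE !eqxx andbT /=.
  by case: (a == i); case: (b == j); rewrite /= ?mul0r ?mulr0 ?mul1r ?mulr1.
apply: (le_trans (unormM _ _)); rewrite mulrAC ler_wpM2r ?nu_ge0 //.
exact: unormM.
Qed.

End NormBasics.

Section UltrafilterLimits.
Variables (omega : set_system nat) (omegaU : UltraFilter omega).
Hypothesis omegaN : nonprincipal omega.

(** If a singleton belonged to [omega], every member of [omega] would contain that point, and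
    maximality would make [omega] principal. Hence points can be removed one at a time. *)
Lemma nonprincipal_tail m : omega [set n | (m <= n)%N].
Proof.
elim: m => [|m IH]; first exact: filterS filterT.
have [om|om] := in_ultra_setVsetC [set m] omegaU.
  exfalso; apply: (omegaN (x := m)); apply: esym.
  apply: (max_filter (principal_filter_proper m)) => A omA.
  apply/principal_filterP.
  by have [x [/= Ax <-]] := @filter_ex _ _ _ _ (filterI omA om).
apply: filterS (filterI IH om) => n [/= mn /eqP nm].
by rewrite ltn_neqAle eq_sym nm.
Qed.

Variable R : realType.

(** The image filter clusters in a compact segment, and for an ultrafilter a cluster point is a
    limit. *)
Lemma real_ultralimit (u : nat -> R) b : (forall n, `|u n| <= b) ->
  exists l : R, forall e : R, 0 < e -> omega [set n | `|u n - l| < e].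
Proof.
move=> ub.
have cpt : compact `[- b, b]%classic := @segment_compact R (- b) b.
pose F : set_system R := fmap u omega.
have FF : ProperFilter F.
  by apply: fmap_proper_filter; exact: ultra_proper.
have Fb : F `[- b, b]%classic.
  apply: (@filterS _ omega _ setT); last exact: filterT.
  by move=> n _ /=; rewrite in_itv /= -ler_norml.
have [l [_ cl]] := cpt F FF Fb.
exists l => e e0.
have [//|on] := in_ultra_setVsetC [set n | `|u n - l| < e] omegaU.
have Fc : F [set x | ~ (`|x - l| < e)] by exact: on.
have nb : nbhs l [set x | `|x - l| < e].
  have := @nbhsx_ballx R R l e e0; apply: filterS => x.
  by rewrite /ball /= distrC.
by have [x [/= h1 h2]] := cl _ _ Fc nb.
Qed.

Lemma complex_ultralimit (u : nat -> R[i]) b : (forall n, normc (u n) <= b) ->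
  exists l : R[i], forall e : R, 0 < e -> omega [set n | normc (u n - l) < e].
Proof.
move=> ub.
have bnd (z : R[i]) : `|complex.Re z| <= normc z /\ `|complex.Im z| <= normc z.
  case: z => x y /=; split; rewrite -sqrtr_sqr ler_wsqrtr //.
    by rewrite lerDl sqr_ge0.
  by rewrite lerDr sqr_ge0.
have nle (z : R[i]) : normc z <= `|complex.Re z| + `|complex.Im z|.
  case: z => x y /=; rewrite -[leRHS]ger0_norm ?addr_ge0 // -sqrtr_sqr.
  apply: ler_wsqrtr; rewrite -[x ^+ 2]real_normK ?num_real //.
  rewrite -[y ^+ 2]real_normK ?num_real //.
  have := normr_ge0 x; have := normr_ge0 y; nra.
have [lr Hr] := @real_ultralimit (fun n => complex.Re (u n)) b
  (fun n => le_trans (bnd (u n)).1 (ub n)).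
have [li Hi] := @real_ultralimit (fun n => complex.Im (u n)) b
  (fun n => le_trans (bnd (u n)).2 (ub n)).
exists (Complex lr li) => e e0.
have e2 : 0 < e / 2 by lra.
apply: filterS (filterI (Hr _ e2) (Hi _ e2)) => n [/= h1 h2].
apply: (le_lt_trans (nle _)); case: (u n) h1 h2 => x y /= h1 h2; lra.
Qed.

End UltrafilterLimits.

Definition bounded_fun (R : realType) (U : normed_unitary R) (X : Type)
    (F : X -> 'M[R[i]]_(udim U)) :=
  exists b, forall x, unorm (F x) <= b.
Arguments bounded_fun {R} U {X}.

Section MatrixLimits.
Variables (omega : set_system nat) (omegaU : UltraFilter omega).
Hypothesis omegaN : nonprincipal omega.
Variables (R : realType) (U : normed_unitary R).
Local Notation C := R[i].
Local Notation k := (udim U).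
Local Notation nu := (@unorm R U).

Definition ultraconv (A : nat -> 'M[C]_k) (L : 'M[C]_k) :=
  forall e : R, 0 < e -> omega [set n | nu (A n - L) < e].

(** The norm is equivalent to the entrywise one: bounded matrices have bounded entries, and the
    finitely many entrywise ultralimits assemble to a limit in norm. *)
Lemma ultraconv_exists A : bounded_fun U A -> exists L, ultraconv A L.
Proof.
move=> [b Ab].
have ex (ij : 'I_k * 'I_k) : exists l : R[i], forall e : R, 0 < e ->
    omega [set n | normc (A n ij.1 ij.2 - l) < e].
  have [c c0 cb] := entry_le_nu ij.1 ij.2.
  apply: (@complex_ultralimit _ omegaU R (fun n => A n ij.1 ij.2) (c * b)) => n.
  by apply: (le_trans (cb _)); rewrite ler_wpM2l.
have [l Hl] := choice ex.
exists (\matrix_(i, j) l (i, j)) => e e0.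
pose s := \sum_i \sum_j nu (delta_mx i j : 'M[C]_k).
have s0 : 0 <= s.
  by apply: sumr_ge0 => i _; apply: sumr_ge0 => j _; exact: nu_ge0.
(* In dimension 0 the sum [s] vanishes, hence [s + 1]. *)
pose d := e / (s + 1).
have d0 : 0 < d by apply: divr_gt0 => //; lra.
have all_close : omega [set n | forall ij : 'I_k * 'I_k,
    normc (A n ij.1 ij.2 - l ij) < d].
  have := @filter_forall nat ('I_k * 'I_k)%type
    (fun ij n => normc (A n ij.1 ij.2 - l ij) < d) omega _.
  by apply=> ij; exact: Hl.
apply: filterS all_close => n /= close.
apply: (le_lt_trans (nu_le_entries _)).
apply: (@le_lt_trans _ _ (d * s)).
  rewrite /s mulr_sumr; apply: ler_sum => i _.
  rewrite mulr_sumr; apply: ler_sum => j _.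
  apply: ler_wpM2r; first exact: nu_ge0.
  by rewrite !mxE; exact/ltW/(close (i, j)).
by rewrite /d mulrAC ltr_pdivrMr ?ltr_pM2l ?ltrDl // ltr_wpDl.
Qed.

Lemma ultraconv_unique A L L' : ultraconv A L -> ultraconv A L' -> L = L'.
Proof.
move=> AL AL'; apply/eqP; rewrite -subr_eq0; apply/eqP/nu_eps0 => e e0.
have e2 : 0 < e / 2 by lra.
have [n [/= h1 h2]] := @filter_ex _ _ _ _ (filterI (AL _ e2) (AL' _ e2)).
have := nu_tri (A n) L L'; rewrite (nu_distC L (A n)); lra.
Qed.

Definition ultralim A := xget 0 [set L | ultraconv A L].

Lemma ultralimP A : bounded_fun U A -> ultraconv A (ultralim A).
Proof.
by move=> /ultraconv_exists[L AL]; rewrite /ultralim; case: xgetP => // /(_ L).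
Qed.

Lemma ultralim_eq A L : ultraconv A L -> ultralim A = L.
Proof.
move=> AL; apply: (ultraconv_unique _ AL).
by rewrite /ultralim; case: xgetP => // /(_ L).
Qed.

Lemma ultraconvD A A' L L' : ultraconv A L -> ultraconv A' L' ->
  ultraconv (fun n => A n + A' n) (L + L').
Proof.
move=> AL AL' e e0; have e2 : 0 < e / 2 by lra.
apply: filterS (filterI (AL _ e2) (AL' _ e2)) => n [/= h1 h2].
have := unormD (A n - L) (A' n - L').
by rewrite addrACA -opprD; lra.
Qed.

Lemma ultraconv_mul A B D L : ultraconv A L ->
  ultraconv (fun n => B *m A n *m D) (B *m L *m D).
Proof.
move=> AL e e0.
pose c := nu B * nu D + 1.
have c0 : 0 < c by rewrite ltr_wpDl // mulr_ge0 ?nu_ge0.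
have ec : 0 < e / c by exact: divr_gt0.
apply: filterS (AL _ ec) => n /= h.
rewrite -mulmxBl -mulmxBr; apply: le_lt_trans (_ : c * nu (A n - L) < e).
  apply: (le_trans (unormM _ _)).
  apply: (@le_trans _ _ (nu B * nu (A n - L) * nu D)).
    by rewrite ler_wpM2r ?nu_ge0 // unormM.
  rewrite mulrAC /c ler_wpM2r ?nu_ge0 //; lra.
by rewrite mulrC -ltr_pdivlMr.
Qed.

Lemma ultraconvM A A' L L' b : (forall n, nu (A' n) <= b) ->
  ultraconv A L -> ultraconv A' L' ->
  ultraconv (fun n => A n *m A' n) (L *m L').
Proof.
move=> A'b AL AL' e e0.
have b0 : 0 <= b := le_trans (nu_ge0 _) (A'b 0%N).
pose c := b + nu L + 1.
have c0 : 0 < c by have := nu_ge0 L; rewrite /c; lra.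
have ec : 0 < e / c by exact: divr_gt0.
apply: filterS (filterI (AL _ ec) (AL' _ ec)) => n [/=].
rewrite !ltr_pdivlMr // => h1 h2.
have -> : A n *m A' n - L *m L' = (A n - L) *m A' n + L *m (A' n - L').
  by rewrite mulmxBl mulmxBr subrKA.
apply: (le_lt_trans (unormD _ _)).
have := unormM (A n - L) (A' n); have := unormM L (A' n - L').
have := A'b n; have := nu_ge0 (A n - L); have := nu_ge0 (A' n - L').
have := nu_ge0 L; rewrite /c in h1 h2 *.
set x := nu (A n - L) in h1 *; set y := nu (A' n - L') in h2 *.
set l := nu L in h1 h2 *; set z := nu (A' n).
move=> l0 y0 x0 zb m1 m2.
have m3 : x * z <= x * b by rewrite ler_wpM2l.
suff : x * b + l * y < e by lra.
(* Both errors are replaced by the larger one, to which [h1] or [h2] applies. *)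
have [xy|xy] := leP x y.
  have : x * b <= y * b by rewrite ler_wpM2r.
  by rewrite !mulrDr in h2 *; lra.
have : l * y <= l * x by rewrite ler_wpM2l // ltW.
by rewrite !mulrDr in h1 *; lra.
Qed.

Lemma ultraconv_bound A L B b : ultraconv A L ->
  omega [set n | nu (A n - B) <= b] -> nu (L - B) <= b.
Proof.
move=> AL Ab; apply/ler_addgt0Pr => e e0.
have [n [/= h1 h2]] := @filter_ex _ _ _ _ (filterI (AL _ e0) Ab).
have := nu_tri (A n) L B; rewrite (nu_distC L (A n)); lra.
Qed.

Lemma ultraconv_eq A A' L : omega [set n | A n = A' n] ->
  ultraconv A L -> ultraconv A' L.
Proof.
by move=> AA' AL e e0; apply: filterS (filterI AA' (AL e e0)) => n [/= <-].
Qed.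

End MatrixLimits.

(** * Means *)

(** Constant matrices pass through a mean on both sides, and [mean_bound] takes the place of
    positivity and normalization: with [b = 0] it gives the mean of a constant. *)
Record is_mean (R : realType) (U : normed_unitary R) (X : Type)
    (L : (X -> 'M[R[i]]_(udim U)) -> 'M[R[i]]_(udim U)) : Prop := IsMean {
  meanD : forall F F', bounded_fun U F -> bounded_fun U F' ->
    L (fun x => F x + F' x) = L F + L F';
  meanM : forall B D F, bounded_fun U F ->
    L (fun x => B *m F x *m D) = B *m L F *m D;
  mean_adj : forall F, bounded_fun U F ->
    L (fun x => adjmx (F x)) = adjmx (L F);
  mean_bound : forall F B b, (forall x, unorm (F x - B) <= b) ->
    unorm (L F - B) <= b }.
Arguments is_mean {R} U {X}.

Section Means.
Variables (omega : set_system nat) (omegaU : UltraFilter omega).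
Hypothesis omegaN : nonprincipal omega.
Variables (R : realType) (U : normed_unitary R).
Local Notation C := R[i].
Local Notation k := (udim U).
Local Notation nu := (@unorm R U).
Hypothesis nu_adj : forall A, nu (adjmx A) = nu A.

Lemma bounded_near X (F : X -> 'M[C]_k) B b :
  (forall x, nu (F x - B) <= b) -> bounded_fun U F.
Proof.
move=> Fb; exists (b + nu B) => x.
by have := nu_tri B (F x) 0; rewrite !subr0; have := Fb x; lra.
Qed.

Lemma bounded_funD X (F F' : X -> 'M[C]_k) :
  bounded_fun U F -> bounded_fun U F' ->
  bounded_fun U (fun x => F x + F' x).
Proof.
move=> [b Fb] [b' F'b]; exists (b + b') => x.
by apply: (le_trans (unormD _ _)); rewrite lerD.
Qed.

Lemma bounded_funM X (F F' : X -> 'M[C]_k) :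
  bounded_fun U F -> bounded_fun U F' ->
  bounded_fun U (fun x => F x *m F' x).
Proof.
move=> [b Fb] [b' F'b]; exists (b * b') => x.
by apply: (le_trans (unormM _ _)); rewrite ler_pM ?nu_ge0.
Qed.

Lemma bounded_cst X (B : 'M[C]_k) : bounded_fun U (fun _ : X => B).
Proof. by exists (nu B). Qed.

Lemma bounded_mul X (F : X -> 'M[C]_k) B D : bounded_fun U F ->
  bounded_fun U (fun x => B *m F x *m D).
Proof.
move=> Fb; apply: bounded_funM; last exact: bounded_cst.
by apply: bounded_funM => //; exact: bounded_cst.
Qed.

Lemma mean_cst X (L : (X -> 'M[C]_k) -> 'M[C]_k) B :
  is_mean U L -> L (fun=> B) = B.
Proof.
move=> Lm; apply/eqP; rewrite -subr_eq0; apply/eqP/nu_eq0.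
by apply: (mean_bound Lm) => x; rewrite subrr nu0.
Qed.

Lemma mean_norm X (L : (X -> 'M[C]_k) -> 'M[C]_k) F b :
  is_mean U L -> (forall x, nu (F x) <= b) -> nu (L F) <= b.
Proof.
move=> Lm Fb; rewrite -[L F]subr0; apply: (mean_bound Lm) => x.
by rewrite subr0.
Qed.

Lemma mean_eval X (x : X) : is_mean U (fun F => F x).
Proof. by split. Qed.

Lemma bounded_means X (I : Type) (L : I -> (X -> 'M[C]_k) -> 'M[C]_k) F :
  (forall i, is_mean U (L i)) -> bounded_fun U F ->
  bounded_fun U (fun i => L i F).
Proof. by move=> Lm [b Fb]; exists b => i; exact: mean_norm. Qed.

(** The closure property behind all iterated averages below. *)
Lemma mean_comp X (I : Type) (M : (I -> 'M[C]_k) -> 'M[C]_k)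
    (L : I -> (X -> 'M[C]_k) -> 'M[C]_k) :
  is_mean U M -> (forall i, is_mean U (L i)) ->
  is_mean U (fun F => M (fun i => L i F)).
Proof.
move=> Mm Lm; split=> [F F' Fb Fb'|B D F Fb|F Fb|F B b Fb].
- rewrite -(meanD Mm); try exact: bounded_means.
  by congr M; apply/funext => i; exact: meanD.
- rewrite -(meanM Mm); last exact: bounded_means.
  by congr M; apply/funext => i; exact: meanM.
- rewrite -(mean_adj Mm); last exact: bounded_means.
  by congr M; apply/funext => i; exact: mean_adj.
- by apply: (mean_bound Mm) => i; exact: mean_bound.
Qed.

Lemma mean_ultralim : is_mean U (@ultralim omega R U).
Proof.
split=> [F F' Fb Fb'|B D F Fb|F Fb|F B b Fb].
- by apply: ultralim_eq; apply: ultraconvD; exact: ultralimP.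
- by apply: ultralim_eq; apply: ultraconv_mul; exact: ultralimP.
- apply: ultralim_eq => e e0; apply: filterS (ultralimP omegaU Fb e0) => n /=.
  by rewrite -adjmxB nu_adj.
- apply: ultraconv_bound (_ : omega _).
    by apply: ultralimP; exact: bounded_near Fb.
  by apply: filterS filterT => n _; exact: Fb.
Qed.

Definition average n (a : nat -> 'M[C]_k) : 'M[C]_k :=
  (n.+1%:R : C)^-1 *: \sum_(j < n.+1) a j.

Lemma normc_inv_nat n : normc ((n.+1%:R : C)^-1) = (n.+1%:R : R)^-1.
Proof. by rewrite normcV normcMn normc1. Qed.

Lemma nu_average n a b : (forall j, nu (a j) <= b) -> nu (average n a) <= b.
Proof.
move=> ab; rewrite /average unormZ normc_inv_nat mulrC ler_pdivrMr ?ltr0n //.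
apply: (le_trans (nu_sum _ _ _)).
apply: (@le_trans _ _ (\sum_(j < n.+1) b)); first exact: ler_sum.
by rewrite sumr_const card_ord mulr_natr.
Qed.

Lemma averageB n a B : average n (fun j => a j - B) = average n a - B.
Proof.
rewrite /average sumrB sumr_const card_ord scalerBr; congr (_ - _).
rewrite -[B *+ _]scaler_nat scalerA mulVf ?scale1r //.
Qed.

Lemma mean_average n : is_mean U (average n).
Proof.
rewrite /average; split=> [F F' Fb Fb'|B D F Fb|F Fb|F B b Fb].
- by rewrite big_split scalerDr.
- by rewrite -mulmx_suml -mulmx_sumr scalemxAl scalemxAr.
- rewrite adjmxZ fmorphV rmorph_nat; congr (_ *: _).
  rewrite /adjmx linear_sum /= (raddf_sum (map_mx Num.conj)) //.
- by rewrite -averageB; exact: nu_average.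
Qed.

Definition cesaro (a : nat -> 'M[C]_k) : 'M[C]_k :=
  ultralim omega (fun n => average n a).

Lemma mean_cesaro : is_mean U cesaro.
Proof. exact: (mean_comp mean_ultralim mean_average). Qed.

Lemma eq_cesaro a a' : (forall j, a j = a' j) -> cesaro a = cesaro a'.
Proof. by move=> /funext ->. Qed.

(** The averages of the sequence and of its shift differ by the telescoped boundary term
    [(a n.+1 - a 0) / n.+1], which tends to 0. *)
Lemma cesaro_shift a : bounded_fun U a -> cesaro (fun j => a j.+1) = cesaro a.
Proof.
move=> [b ab]; have b0 : 0 <= b := le_trans (nu_ge0 _) (ab 0%N).
apply: ultralim_eq; rewrite -[cesaro a]addr0.
have -> : (fun n => average n (fun j => a j.+1)) =
  (fun n => average n a + (n.+1%:R : C)^-1 *: (a n.+1 - a 0%N)).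
  apply/funext => n; rewrite /average -scalerDr; congr (_ *: _).
  rewrite [LHS]big_ord_recr [in RHS]big_ord_recl /=.
  by rewrite [in RHS](addrC (a 0%N)) addrACA subrr addr0.
apply: ultraconvD.
  by apply: ultralimP => //; exists b => n; exact: nu_average.
move=> e e0; pose m := Num.Def.truncn ((b + b) / e).
apply: filterS (nonprincipal_tail omegaU omegaN m) => n /= mn.
rewrite subr0 unormZ normc_inv_nat mulrC ltr_pdivrMr ?ltr0n //.
apply: (@le_lt_trans _ _ (b + b)).
  by apply: (le_trans (nuB _ _)); rewrite lerD.
rewrite mulrC -ltr_pdivrMr //.
apply: (lt_le_trans (truncnS_gt _)).
by rewrite ler_nat ltnS.
Qed.

End Means.

Lemma commgMl (G : groupType) (x y z : G) :
  ([~ x * y, z] = [~ x, z] ^ y * [~ y, z])%g.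
Proof. by rewrite !commgEl !conjgE !invgM !mulgA !mulgK. Qed.

(** Exchanging the first two factors of a triple product changes it on the right by a conjugate of
    their commutator, so it stays in the same coset of a normal subgroup containing that
    commutator. *)
Lemma swap_commg (G : groupType) (x y z : G) :
  ((y * (x * z))^-1 * (x * (y * z)) = [~ x, y] ^ z)%g.
Proof. by rewrite commgEl !conjgE !invgM !mulgA. Qed.

(** * Invariant means on functions on a metabelian quotient *)

Section InvariantMean.
Variables (omega : set_system nat) (omegaU : UltraFilter omega).
Hypothesis omegaN : nonprincipal omega.
Variables (R : realType) (U : normed_unitary R).
Local Notation C := R[i].
Local Notation k := (udim U).
Local Notation nu := (@unorm R U).
Hypothesis nu_adj : forall A, nu (adjmx A) = nu A.

Variables (G : groupType) (N : set G) (t h : G).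
Hypothesis N1 : N 1%g.
Hypothesis NM : forall x y, N x -> N y -> N (x * y)%g.
Hypothesis NJ : forall x g, N x -> N (x ^ g)%g.
Variable b : nat -> G.
Hypothesis bE : forall i, b i = (h ^ (t ^+ i))%g.
Hypothesis comm_conj : forall i j, N [~ b i, b j]%g.
Hypothesis gen : forall P : set G, (forall x y, P x -> P y -> P (x * y)%g) ->
  (forall x, P x -> P x^-1%g) -> P h -> P t -> forall g, P g.

(** Functions on G / N are kept as functions on [G], so that no quotient group has to be formed. *)
Definition right_invariant (X : Type) (F : G -> X) :=
  forall x c, N c -> F (x * c)%g = F x.

Lemma coset_eq X (F : G -> X) x y : right_invariant F -> N (x^-1 * y)%g ->
  F y = F x.
Proof. by move=> Fi Nxy; rewrite -[y](mulVKg x) Fi. Qed.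

Lemma commute_mod_expg i j m : N [~ b i ^+ m, b j]%g.
Proof.
elim: m => [|m IH]; first by rewrite expg0 comm1g.
rewrite expgSr commgMl.
by apply: NM; [exact: NJ|exact: comm_conj].
Qed.

(* Iterated Cesaro limits in the pairwise almost commuting directions
   [b 0, ..., b (n - 1)]. *)
Fixpoint mean_steps n (x : G) (F : G -> 'M[C]_k) : 'M[C]_k :=
  if n is m.+1 then cesaro omega (fun j => mean_steps m (b m ^+ j * x)%g F)
  else F x.

Lemma mean_mean_steps n x : is_mean U (mean_steps n x).
Proof.
elim: n x => [|n IH] x /=; first exact: mean_eval.
exact: (mean_comp (mean_cesaro omegaU nu_adj)).
Qed.

Lemma bounded_mean_steps n (X : Type) (f : X -> G) F : bounded_fun U F ->
  bounded_fun U (fun x => mean_steps n (f x) F).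
Proof.
move=> Fb.
apply: (@bounded_means _ _ _ _ (fun x => mean_steps n (f x))) => // x.
exact: mean_mean_steps.
Qed.

Lemma mean_steps_right_invariant n F : right_invariant F ->
  right_invariant (fun x => mean_steps n x F).
Proof.
move=> Fi; elim: n => [|n IH] x c Nc; first exact: Fi.
by apply: eq_cesaro => j; rewrite (mulgA (b n ^+ j)%g); exact: IH.
Qed.

Lemma swap_coset X (F : G -> X) i m j x : right_invariant F ->
  F (b i ^+ m * (b j * x))%g = F (b j * (b i ^+ m * x))%g.
Proof.
move=> Fi; apply: (coset_eq Fi).
rewrite swap_commg.
exact/NJ/commute_mod_expg.
Qed.

(** Modulo [N] the element [b i] commutes with every averaging direction, so the translation can be
    moved to the base point. *)
Lemma mean_steps_translate n x i F : right_invariant F ->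
  mean_steps n x (fun y => F (b i * y)%g) = mean_steps n (b i * x)%g F.
Proof.
move=> Fi; elim: n x => [//|n IH] x /=.
apply: eq_cesaro => j; rewrite IH; apply: esym.
apply: (@swap_coset _ (fun x => mean_steps n x F)).
exact: mean_steps_right_invariant.
Qed.

(** The outermost Cesaro limit absorbs its own direction by [cesaro_shift]; any earlier direction is
    first moved past it modulo [N]. *)
Lemma mean_steps_invariant n x i F : (i < n)%N -> right_invariant F ->
  bounded_fun U F -> mean_steps n (b i * x)%g F = mean_steps n x F.
Proof.
move=> + Fi Fb; elim: n x => [//|n IH] x /=.
rewrite ltnS leq_eqVlt => /orP[/eqP ->|/IH {}IH].
  rewrite -[RHS](cesaro_shift omegaU omegaN); last exact: bounded_mean_steps.
  by apply: eq_cesaro => j; rewrite mulgA -expgSr.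
apply: eq_cesaro => j.
rewrite -[RHS]IH.
apply: (@swap_coset _ (fun x => mean_steps n x F)).
exact: mean_steps_right_invariant.
Qed.

Definition normal_mean (F : G -> 'M[C]_k) : 'M[C]_k :=
  ultralim omega (fun n => mean_steps n 1%g F).

Lemma mean_normal_mean : is_mean U normal_mean.
Proof.
apply: (mean_comp (mean_ultralim omegaU nu_adj)) => n.
exact: mean_mean_steps.
Qed.

(** Each [b i] is among the averaging directions as soon as [n > i], hence for [omega]-almost all
    [n]. *)
Lemma normal_mean_invariant i F : right_invariant F -> bounded_fun U F ->
  normal_mean (fun x => F (b i * x)%g) = normal_mean F.
Proof.
move=> Fi Fb; apply: ultralim_eq => //.
apply: (ultraconv_eq omegaU _ (ultralimP omegaU
  (_ : bounded_fun U (fun n => mean_steps n 1%g F)))).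
  apply: filterS (nonprincipal_tail omegaU omegaN i.+1) => n /= lt_in.
  by rewrite mean_steps_translate // mean_steps_invariant.
apply: (@bounded_means _ _ _ _ (fun n => mean_steps n 1%g)) => // n.
exact: mean_mean_steps.
Qed.

Lemma eq_normal_mean F F' : (forall x, F x = F' x) ->
  normal_mean F = normal_mean F'.
Proof. by move=> /funext ->. Qed.

Definition group_mean (F : G -> 'M[C]_k) : 'M[C]_k :=
  cesaro omega (fun j => normal_mean (fun x => F (t ^+ j * x)%g)).

Lemma bounded_translate (F : G -> 'M[C]_k) g : bounded_fun U F ->
  bounded_fun U (fun x => F (g * x)%g).
Proof. by move=> [c Fc]; exists c. Qed.

Lemma mean_translate L g : is_mean U L ->
  is_mean U (fun F : G -> 'M[C]_k => L (fun x => F (g * x)%g)).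
Proof.
move=> Lm; split=> [F F' Fb Fb'|B D F Fb|F Fb|F B c Fc].
- exact: (meanD Lm (bounded_translate g Fb) (bounded_translate g Fb')).
- exact: (meanM Lm B D (bounded_translate g Fb)).
- exact: (mean_adj Lm (bounded_translate g Fb)).
- by apply: (mean_bound Lm) => x; exact: Fc.
Qed.

Lemma mean_group_mean : is_mean U group_mean.
Proof.
apply: (mean_comp (mean_cesaro omegaU nu_adj)) => j.
exact/mean_translate/mean_normal_mean.
Qed.

Lemma right_invariant_translate X (F : G -> X) g : right_invariant F ->
  right_invariant (fun x => F (g * x)%g).
Proof. by move=> Fi x c Nc; rewrite mulgA; exact: Fi. Qed.

Lemma group_mean_invariant g F : right_invariant F -> bounded_fun U F ->
  group_mean (fun x => F (g * x)%g) = group_mean F.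
Proof.
(* The elements under which the mean is invariant form a subgroup, so the generators are enough. *)
pose P g := forall F, right_invariant F -> bounded_fun U F ->
  group_mean (fun x => F (g * x)%g) = group_mean F.
move: F; rewrite -[forall F, _]/(P g); move: g; apply: gen.
- move=> x y Px Py F Fi Fb.
  rewrite -(Px F Fi Fb) -[RHS](Py (fun z => F (x * z)%g)).
  + have -> : (fun z => F (x * y * z)%g) = (fun z => F (x * (y * z))%g)
      by apply/funext => z; rewrite mulgA.
    by [].
  + exact: (right_invariant_translate x Fi).
  + exact: (bounded_translate x Fb).
- move=> x Px F Fi Fb; rewrite -[LHS](Px (fun z => F (x^-1 * z)%g)).
  + by have -> : (fun z => F (x^-1 * (x * z))%g) = F
      by apply/funext => z; rewrite mulKg.
  + exact: (right_invariant_translate x^-1%g Fi).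
  + exact: (bounded_translate x^-1%g Fb).
(* For [h]: since h t^j = t^j b_j, the translation is absorbed by the inner mean. Only conjugates of
   [h] with nonnegative exponents occur. *)
- move=> F Fi Fb; apply: eq_cesaro => j.
  rewrite -[RHS](normal_mean_invariant j).
  + by apply: eq_normal_mean => x; rewrite bE conjgE !mulgA mulgV mul1g.
  + exact: (right_invariant_translate (t ^+ j)%g Fi).
  + exact: (bounded_translate (t ^+ j)%g Fb).
- move=> F Fi Fb; rewrite -[RHS](cesaro_shift omegaU omegaN); last first.
    apply: (@bounded_means _ _ _ _
      (fun j F => normal_mean (fun x => F (t ^+ j * x)%g))) Fb => j.
    exact/mean_translate/mean_normal_mean.
  apply: eq_cesaro => j; apply: eq_normal_mean => x.
  by rewrite mulgA -expgS.
Qed.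

End InvariantMean.

(** * Almost homomorphisms *)

Section NearUnitary.
Variables (R : realType) (U : normed_unitary R).
Local Notation C := R[i].
Local Notation k := (udim U).
Local Notation nu := (@unorm R U).
Hypothesis nu_adj : forall A, nu (adjmx A) = nu A.

(* The Cayley transform of the skew part of [u^* A - 1] is unitary and agrees
   with [u^* A] to first order. *)
Lemma near_unitary (u A : 'M[C]_k) (eta kappa : R) : u \is unitarymx ->
  eta <= 1 -> nu (A - u) <= eta -> nu (adjmx A *m A - 1%:M) <= kappa ->
  exists2 W, W \is unitarymx & nu (W - A) <= kappa + 2 * eta ^+ 2.
Proof.
move=> uU eta1 Au AA.
have uU' := adj_unitary uU.
pose B := adjmx u *m A; have BA : adjmx u *m A = B by [].
have BB : adjmx A *m A = adjmx B *m B.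
  rewrite /B adjmxM adjmxK mulmxA -[adjmx A *m u *m _]mulmxA.
  by rewrite (mul_unitary_adj uU) mulmx1.
pose D := B - 1%:M; have BD : B = 1%:M + D by rewrite /D addrC subrK.
have nD : nu D <= eta.
  rewrite /D -(mul_adj_unitary uU) /B -mulmxBr.
  by have := nuUl (U := U) (A - u) uU'; lra.
clearbody B D.
have eta0 : 0 <= eta := le_trans (nu_ge0 _) nD.
pose E := adjmx A *m A - 1%:M.
(* Expanding A^* A as the product of D^* + 1 and D + 1 shows that D + D^* is bounded by
   [kappa + eta ^+ 2]. *)
have EE : D + adjmx D = E - adjmx D *m D.
  rewrite /E BB BD adjmxD adjmx1 mulmxDl !mulmxDr !mul1mx mulmx1.
  rewrite -[1%:M + _ + _]addrA [1%:M + _]addrC addrK.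
  by rewrite addrA addrK.
have nE : nu E <= kappa := AA.
clearbody E.
pose Z := D - adjmx D; pose H := 2^-1 *: Z.
have nZ : nu Z <= 2 * eta.
  by apply: (le_trans (nuB _ _)); rewrite nu_adj; lra.
have nH : nu H <= eta by rewrite nu_half; lra.
pose J := 2^-1 *: H.
have nJ : nu J <= eta / 2 by rewrite nu_half; lra.
have adjJ : adjmx J = - J.
  rewrite /J /H /Z !adjmxZ adjmxB adjmxK fmorphV rmorph_nat.
  by rewrite -!scalerN opprB.
have half2 : (2^-1 + 2^-1 : C) = 1 by rewrite -[2^-1]mul1r -splitr.
have HJ : H = J + J.
  by rewrite /J -scalerDl half2 scale1r.
have HD : H - D = 2^-1 *: - (D + adjmx D).
  have DD : 2^-1 *: (D + D) = D by rewrite scalerDr -scalerDl half2 scale1r.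
  rewrite /H /Z -{3}DD -scalerBr; congr (_ *: _).
  by rewrite opprD addrAC opprD addrA subrr add0r addrC.
clearbody H J.
(* As [J] is skew, [P] and [Q] are adjoint to each other; they commute, so the Cayley transform
   [P^-1 Q] is unitary. *)
pose P := 1%:M - J; pose Q := 1%:M + J.
have adjP : adjmx P = Q by rewrite /P adjmxB adjJ adjmx1 opprK.
have adjQ : adjmx Q = P by rewrite /Q adjmxD adjJ adjmx1.
have PQ : P *m Q = Q *m P.
  rewrite /P /Q mulmxBl mulmxDl !mul1mx mulmxDr mulmxBr !mulmx1.
  by rewrite opprD addrA addrK addrA subrK.
(* The left kernel [V] of [P] satisfies [V = V J], and [nu J <= 1 / 2] makes it vanish. *)
have Punit : P \in unitmx.
  rewrite -row_free_unit -kermx_eq0; apply/eqP.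
  set V := kermx P; have VP : V *m P = 0 by apply/eqP; rewrite -sub_kermx.
  have VJ : V = V *m J.
    by apply/eqP; rewrite -subr_eq0 -{1}[V]mulmx1 -mulmxBr VP.
  apply: nu_eq0; have := unormM V J; rewrite -VJ.
  have := nu_ge0 V => V0 VV.
  have : nu V * nu J <= nu V * 2^-1 by rewrite ler_wpM2l //; lra.
  lra.
pose Y := invmx P.
have QY : Q *m adjmx Y = 1%:M by rewrite -adjP -adjmxM mulVmx // adjmx1.
pose W := Y *m Q.
have WU : W \is unitarymx.
  apply: unitary_adjP; rewrite /W adjmxM adjQ -mulmxA (mulmxA Q) -PQ.
  by rewrite -(mulmxA P) QY mulmx1 mulVmx.
exists (u *m W); first exact: (mul_unitarymx uU WU).
have -> : u *m W - A = u *m (W - B).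
  by rewrite mulmxBr -BA [u *m (_ *m A)]mulmxA (mul_unitary_adj uU) mul1mx.
rewrite nuUl //.
set X := W - B.
(* The first-order terms cancel: [P X] is the sum of [H - D], which is minus half of D + D^*, and
   [J D]. *)
have PX : P *m X = 2^-1 *: (adjmx D *m D - E) + J *m D.
  rewrite /X mulmxBr /W mulmxA mulmxV // mul1mx.
  rewrite BD.
  have -> : adjmx D *m D - E = - (D + adjmx D) by rewrite EE opprB.
  rewrite -HD HJ /P /Q [(_ - J) *m (_ + D)]mulmxDr mulmx1 mulmxBl mul1mx.
  by rewrite !opprD !opprK !addrA [1%:M + J]addrC addrK.
have nPX : nu (P *m X) <= kappa / 2 + eta ^+ 2.
  rewrite PX; apply: (le_trans (unormD _ _)).
  have n1 : nu (adjmx D *m D) <= eta ^+ 2.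
    apply: (le_trans (unormM _ _)); rewrite nu_adj expr2.
    by rewrite ler_pM ?nu_ge0.
  have n2 : nu (J *m D) <= eta ^+ 2 / 2.
    apply: (le_trans (unormM _ _)).
    have -> : eta ^+ 2 / 2 = eta / 2 * eta by rewrite expr2 mulrAC.
    by rewrite ler_pM ?nu_ge0.
  have := nuB (adjmx D *m D) E; rewrite nu_half => n3.
  lra.
(* Since [nu J <= 1 / 2], the norm of [X] is at most twice that of [P X]. *)
have XE : X = J *m X + P *m X by rewrite /P mulmxBl mul1mx addrC subrK.
have nX : nu X <= nu (J *m X) + nu (P *m X) by rewrite {1}XE unormD.
have nJX : nu (J *m X) <= nu X / 2.
  apply: (le_trans (unormM _ _)); rewrite mulrC.
  by rewrite ler_wpM2l ?nu_ge0 //; lra.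
lra.
Qed.

End NearUnitary.

(** * Averaging step that squares the defect *)

Section NewtonStep.
Variables (omega : set_system nat) (omegaU : UltraFilter omega).
Hypothesis omegaN : nonprincipal omega.
Variables (R : realType) (U : normed_unitary R).
Local Notation C := R[i].
Local Notation k := (udim U).
Local Notation nu := (@unorm R U).
Hypothesis nu_adj : forall A, nu (adjmx A) = nu A.

Variables (G : groupType) (N : set G).
Hypothesis NJ : forall x g, N x -> N (x ^ g)%g.
Variable M : (G -> 'M[C]_k) -> 'M[C]_k.
Hypothesis Mmean : is_mean U M.
Lemma eqM F F' : (forall x, F x = F' x) -> M F = M F'.
Proof. by move=> /funext ->. Qed.

Hypothesis Minv : forall g F, right_invariant N F -> bounded_fun U F ->
  M (fun x => F (g * x)%g) = M F.

Definition almost_hom (eta : R) (phi : G -> 'M[C]_k) : Prop :=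
  [/\ forall g, phi g \is unitarymx, right_invariant N phi &
      forall g h, nu (phi (g * h)%g - phi g *m phi h) <= eta].

(* [A g] averages [phi (g x) phi(x)^*] over [x]; it is multiplicative up to
   [4 eta ^+ 2] because the first-order errors average to zero. *)
Lemma averaged_almost_hom eta phi : almost_hom eta phi ->
  exists A : G -> 'M[C]_k,
  [/\ forall g, nu (A g - phi g) <= eta, forall g c, N c -> A (g * c)%g = A g,
      forall g, nu (adjmx (A g) *m A g - 1%:M) <= 4 * eta ^+ 2 &
      forall g h, nu (A (g * h)%g - A g *m A h) <= 4 * eta ^+ 2].
Proof.
move=> [phiU phiN phiM].
have phiU' g := adj_unitary (phiU g).
pose F g x := phi (g * x)%g *m adjmx (phi x).
have FU g x : F g x \is unitarymx by exact: (mul_unitarymx (phiU _) (phiU' _)).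
have Fb g : bounded_fun U (F g).
  by exists (nu 1%:M) => x; rewrite (nuU (FU g x)).
have FN g : right_invariant N (F g).
  by move=> x c Nc; rewrite /F (mulgA g) !(phiN _ _ Nc).
have Fnear g x : nu (F g x - phi g) <= eta.
  have -> : F g x - phi g = (phi (g * x)%g - phi g *m phi x) *m adjmx (phi x).
    rewrite mulmxBl -[phi g *m _ *m _]mulmxA (mul_unitary_adj (phiU x)).
    by rewrite mulmx1.
  by rewrite (nuUr _ (phiU' x)).
have FM g h x : F (g * h)%g x = F g (h * x)%g *m F h x.
  rewrite /F mulmxA -[_ *m adjmx _ *m _]mulmxA (mul_adj_unitary (phiU _)).
  by rewrite mulmx1 mulgA.
pose A g := M (F g).
have Anear g : nu (A g - phi g) <= eta by exact: (mean_bound Mmean).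
have AN g c : N c -> A (g * c)%g = A g.
  move=> Nc; rewrite /A; have -> // : F (g * c)%g = F g.
  apply/funext => x; rewrite /F; congr (_ *m _).
  have -> : (g * c * x = g * x * (c ^ x))%g by rewrite conjgE !mulgA mulgK.
  by apply: phiN; exact: NJ.
(* The adjoint of [F g x] is [F g^-1 (g * x)], and [M] absorbs the translation. *)
have Aadj g : adjmx (A g) = A g^-1%g.
  rewrite /A -(mean_adj Mmean) // -(Minv g (FN g^-1%g) (Fb g^-1%g)).
  apply: eqM => x.
  by rewrite /F adjmxM adjmxK mulKg.
have A1 : A 1%g = 1%:M.
  rewrite -(mean_cst 1%:M Mmean) /A; apply: eqM => x.
  by rewrite /F mul1g (mul_unitary_adj (phiU x)).
have Ferr g x : nu (F g x - A g) <= 2 * eta.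
  have := nu_tri (phi g) (F g x) (A g).
  rewrite (nu_distC (phi g)); have := Fnear g x; have := Anear g; lra.
have AM g h : nu (A (g * h)%g - A g *m A h) <= 4 * eta ^+ 2.
  (* [F (g * h)] is the pointwise product of a translate of [F g] with [F h]. Expanding around [A g]
     and [A h], the cross terms average to 0 and only the mean of [ab] remains. *)
  pose ab x := (F g (h * x)%g - A g) *m (F h x - A h).
  have abn x : nu (ab x) <= 4 * eta ^+ 2.
    apply: (le_trans (unormM _ _)).
    have -> : 4 * eta ^+ 2 = 2 * eta * (2 * eta) by ring.
    by rewrite ler_pM ?nu_ge0 ?Ferr.
  have abb : bounded_fun U ab by exists (4 * eta ^+ 2).
  have Fgb : bounded_fun U (fun x => F g (h * x)%g).
    by exists (nu 1%:M) => x; rewrite (nuU (FU _ _)).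
  have -> : A (g * h)%g = M ab + A g *m A h.
    have b1 : bounded_fun U (fun x => A g *m F h x *m 1%:M + - (A g *m A h)).
      by apply: bounded_funD; [exact: bounded_mul|exact: bounded_cst].
    have b2 : bounded_fun U (fun x => 1%:M *m F g (h * x)%g *m A h).
      exact: bounded_mul.
    have -> : A (g * h)%g = M (fun x => ab x + (1%:M *m F g (h * x)%g *m A h +
        (A g *m F h x *m 1%:M + - (A g *m A h)))).
      apply: eqM => x; rewrite FM /ab mul1mx mulmx1 mulmxBl !mulmxBr opprB.
      by rewrite addrACA subrK subrKA subrr addr0.
    rewrite (meanD Mmean abb (bounded_funD b2 b1)) (meanD Mmean b2 b1).
    rewrite (meanD Mmean (bounded_mul _ _ (Fb h)) (bounded_cst _ _)).
    rewrite !(meanM Mmean) // (mean_cst _ Mmean) mulmx1 mul1mx subrr addr0.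
    by rewrite (Minv h (FN g) (Fb g)).
  by rewrite addrK; apply: mean_norm.
exists A; split=> // g.
have := AM g^-1%g g; rewrite mulVg A1 -Aadj.
by rewrite (nu_distC 1%:M).
Qed.

(** Making [A g] unitary costs (4 + 2) eta^2. The new defect is thus at most (4 + 3 * 6 + 1) eta^2 =
    23 eta^2, the last 1 bounding the product of two corrections, and this is at most eta / 2 when
    eta <= 1 / 46. *)
Lemma newton_step eta phi : almost_hom eta phi -> eta <= 46^-1 ->
  exists2 phi', almost_hom (eta / 2) phi' &
    forall g, nu (phi' g - phi g) <= 2 * eta.
Proof.
move=> phiH eta46; have [phiU phiN phiM] := phiH.
have eta0 : 0 <= eta := le_trans (nu_ge0 _) (phiM 1%g 1%g).
have e2 : eta ^+ 2 <= 46^-1 * eta by rewrite expr2 ler_wpM2r.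
have e20 : 0 <= eta ^+ 2 by rewrite sqr_ge0.
have [A [Anear AN AA AM]] := averaged_almost_hom phiH.
(* The unitary is chosen as a function of the pair of [phi g] and [A g], so that [phi'] inherits
   invariance under [N]. *)
have ex (p : 'M[C]_k * 'M[C]_k) : exists W, p.1 \is unitarymx ->
    nu (p.2 - p.1) <= eta -> nu (adjmx p.2 *m p.2 - 1%:M) <= 4 * eta ^+ 2 ->
    W \is unitarymx /\ nu (W - p.2) <= 6 * eta ^+ 2.
  have [[u1 [u2 u3]]|no] := pselect (p.1 \is unitarymx /\
    nu (p.2 - p.1) <= eta /\ nu (adjmx p.2 *m p.2 - 1%:M) <= 4 * eta ^+ 2).
    have eta1 : eta <= 1 by lra.
    have [W WU Wn] := near_unitary nu_adj u1 eta1 u2 u3.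
    by exists W => _ _ _; split=> //; lra.
  by exists 0 => h1 h2 h3; case: no.
have [w wP] := choice ex.
pose phi' g := w (phi g, A g).
have phi'P g := wP (phi g, A g) (phiU g) (Anear g) (AA g).
have phi'U g : phi' g \is unitarymx by case: (phi'P g).
have phi'A g : nu (phi' g - A g) <= 6 * eta ^+ 2 by case: (phi'P g).
exists phi'; last first.
  move=> g; have := nu_tri (A g) (phi' g) (phi g).
  have := phi'A g; have := Anear g; lra.
split=> // [g c Nc|g h]; first by rewrite /phi' (phiN _ _ Nc) (AN _ _ Nc).
(* [A g] is written as [phi' g] minus its correction, so that each correction meets only a unitary
   factor or another correction. *)
have -> : phi' (g * h)%g - phi' g *m phi' h =
  (phi' (g * h)%g - A (g * h)%g) + (A (g * h)%g - A g *m A h) -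
  ((phi' g - A g) *m phi' h + (phi' g *m (phi' h - A h) -
   (phi' g - A g) *m (phi' h - A h))).
  rewrite -[phi' g *m (_ - _) - _]mulmxBl subKr mulmxBl mulmxBr.
  by rewrite !subrKA opprB subrKA.
apply: (le_trans (nuB _ _)).
have n1 := phi'A (g * h)%g; have n2 := AM g h.
have n3 := unormD (phi' (g * h)%g - A (g * h)%g) (A (g * h)%g - A g *m A h).
have n4 := unormD ((phi' g - A g) *m phi' h) (phi' g *m (phi' h - A h) -
   (phi' g - A g) *m (phi' h - A h)).
have n5 := nuB (phi' g *m (phi' h - A h)) ((phi' g - A g) *m (phi' h - A h)).
have n6 := nuUr (phi' g - A g) (phi'U h).
have n7 := nuUl (phi' h - A h) (phi'U g).
have n8 := phi'A g; have n9 := phi'A h.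
have n10 : nu ((phi' g - A g) *m (phi' h - A h)) <= 36 * eta ^+ 4.
  apply: (le_trans (unormM _ _)).
  have -> : 36 * eta ^+ 4 = 6 * eta ^+ 2 * (6 * eta ^+ 2) by ring.
  by rewrite ler_pM ?nu_ge0.
have n11 : 36 * eta ^+ 4 <= eta ^+ 2.
  have -> : 36 * eta ^+ 4 = (36 * eta ^+ 2) * eta ^+ 2 by ring.
  have : 36 * eta ^+ 2 <= 1 by lra.
  by move/(ler_wpM2r e20); rewrite mul1r.
lra.
Qed.

End NewtonStep.

(** * Convergence of the iteration *)

Section Convergence.
Variables (omega : set_system nat) (omegaU : UltraFilter omega).
Hypothesis omegaN : nonprincipal omega.
Variables (R : realType) (U : normed_unitary R).
Local Notation C := R[i].
Local Notation k := (udim U).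
Local Notation nu := (@unorm R U).
Hypothesis nu_adj : forall A, nu (adjmx A) = nu A.

Variables (G : groupType) (N : set G).
Hypothesis NJ : forall x g, N x -> N (x ^ g)%g.
Variable M : (G -> 'M[C]_k) -> 'M[C]_k.
Hypothesis Mmean : is_mean U M.
Hypothesis Minv : forall g F, right_invariant N F -> bounded_fun U F ->
  M (fun x => F (g * x)%g) = M F.

Lemma almost_hom_sequence eta phi : almost_hom N eta phi -> eta <= 46^-1 ->
  exists s : nat -> G -> 'M[C]_k,
    (forall n, almost_hom N (eta / 2 ^+ n) (s n)) /\
    (forall n g, nu (s n g - phi g) <= 4 * eta).
Proof.
move=> phiH eta46.
have [_ _ phiM] := phiH.
have eta0 : 0 <= eta := le_trans (nu_ge0 _) (phiM 1%g 1%g).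
have ex (p : R * (G -> 'M[C]_k)) : exists psi, almost_hom N p.1 p.2 ->
    p.1 <= 46^-1 -> almost_hom N (p.1 / 2) psi /\
    forall g, nu (psi g - p.2 g) <= 2 * p.1.
  have [[h1 h2]|no] := pselect (almost_hom N p.1 p.2 /\ p.1 <= 46^-1).
    by have [psi ? ?] := newton_step nu_adj NJ Mmean Minv h1 h2; exists psi.
  by exists p.2 => h1 h2; case: no.
have [step stepP] := choice ex.
pose s := fix s n := if n is m.+1 then step (eta / 2 ^+ m, s m) else phi.
have small n : eta / 2 ^+ n <= 46^-1.
  apply: le_trans eta46; rewrite ler_pdivrMr ?exprn_gt0 // ler_peMr //.
  by rewrite exprn_ege1 // ler1n.
have sH n : almost_hom N (eta / 2 ^+ n) (s n).
  elim: n => [|n IH]; first by rewrite expr0 divr1.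
  have [h _] := stepP (eta / 2 ^+ n, s n) IH (small n).
  by rewrite exprSr invfM [eta * _]mulrA.
exists s; split=> // n g.
(* The bound is the partial sum of the geometric series with terms 2 eta / 2^j. *)
suff : nu (s n g - phi g) <= 4 * eta - 4 * (eta / 2 ^+ n).
  have : 0 <= eta / 2 ^+ n by rewrite divr_ge0 ?exprn_ge0.
  lra.
elim: n => [|n IH]; first by rewrite subrr nu0 expr0 divr1 subrr.
have [_ /(_ g)/= h] := stepP (eta / 2 ^+ n, s n) (sH n) (small n).
have := nu_tri (s n g) (s n.+1 g) (phi g).
have -> : eta / 2 ^+ n.+1 = eta / 2 ^+ n / 2 by rewrite exprSr invfM mulrA.
rewrite /= in IH h *; lra.
Qed.

(** The improving sequence has a pointwise ultralimit by boundedness; unitarity passes to the limit,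
    and the defects [eta / 2 ^+ n] tend to 0. *)
Lemma almost_hom_near_hom eta phi : almost_hom N eta phi -> eta <= 46^-1 ->
  exists psi : G -> 'M[C]_k,
    [/\ forall g, psi g \is unitarymx,
        forall g h, psi (g * h)%g = psi g *m psi h &
        forall g, nu (psi g - phi g) <= 4 * eta].
Proof.
move=> phiH eta46.
have [_ _ phiM] := phiH.
have eta0 : 0 <= eta := le_trans (nu_ge0 _) (phiM 1%g 1%g).
have [s [sH sphi]] := almost_hom_sequence phiH eta46.
have sU n g : s n g \is unitarymx by case: (sH n).
have sb g : bounded_fun U (s^~ g).
  by exists (nu 1%:M) => n; rewrite (nuU (sU n g)).
pose psi g := ultralim omega (s^~ g).
have conv g : ultraconv omega (s^~ g) (psi g) by exact: ultralimP.
have sb1 g n : nu (s n g) <= nu 1%:M by rewrite (nuU (sU n g)).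
exists psi; split=> [g|g h|g].
- apply: unitary_adjP.
  have cadj : ultraconv omega (fun n => adjmx (s n g)) (adjmx (psi g)).
    move=> e e0; apply: filterS (conv g e e0) => n /=.
    by rewrite -adjmxB nu_adj.
  have adjb n : nu (adjmx (s n g)) <= nu 1%:M by rewrite nu_adj.
  apply: (ultraconv_unique omegaU (ultraconvM omegaU adjb (conv g) cadj)).
  move=> e e0; apply: filterS filterT => n _ /=.
  by rewrite (mul_unitary_adj (sU n g)) subrr nu0.
- apply: (ultraconv_unique omegaU (conv (g * h)%g)).
  move=> e e0; have e2 : 0 < e / 2 by lra.
  have cM := ultraconvM omegaU (sb1 h) (conv g) (conv h).
  (* For [n >= m] one has eta / 2^n < e / 2, because n < 2^n. *)
  pose m := Num.Def.truncn (eta / (e / 2)).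
  have tail := nonprincipal_tail omegaU omegaN m.
  apply: filterS (filterI tail (cM _ e2)) => n [/= mn h2].
  have h1 : nu (s n (g * h)%g - s n g *m s n h) < e / 2.
    apply: (@le_lt_trans _ _ (eta / 2 ^+ n)); first by case: (sH n).
    rewrite ltr_pdivrMr ?exprn_gt0 // mulrC -ltr_pdivrMr //.
    apply: (lt_le_trans (truncnS_gt _)).
    by rewrite -natrX ler_nat; apply: leq_trans (ltn_expl n _).
  by have := nu_tri (s n g *m s n h) (s n (g * h)%g) (psi g *m psi h); lra.
- apply: (ultraconv_bound omegaU (conv g)).
  by apply: filterS filterT => n _ /=.
Qed.

End Convergence.

(** * Commutators of displaceable elements *)

Section Displacement.
Variables (omega : set_system nat) (omegaU : UltraFilter omega).
Hypothesis omegaN : nonprincipal omega.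
Variables (R : realType) (U : normed_unitary R).
Local Notation C := R[i].
Local Notation k := (udim U).
Local Notation nu := (@unorm R U).
Variables (G : groupType) (phi : G -> 'M[C]_k) (eps : R).
Hypothesis phiU : forall g, phi g \is unitarymx.
Hypothesis phiM : forall g h, nu (phi (g * h)%g - phi g *m phi h) <= eps.

(* The unitary group is compact, so two of the [phi (t ^+ j)] are close, and
   then [phi (t ^+ n)] is close to 1 for their difference [n]. *)
Lemma power_near_one (t : G) m delta : 0 < delta ->
  exists2 n, (m <= n)%N & nu (phi (t ^+ n)%g - 1%:M) <= eps + delta.
Proof.
move=> d0; pose T n := phi (t ^+ n)%g.
have Tb : bounded_fun U T by exists (nu 1%:M) => n; rewrite (nuU (phiU _)).
have d2 : 0 < delta / 2 by lra.
have cT := ultralimP omegaU Tb d2.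
have [i /= hi] := @filter_ex _ _ _ _ cT.
have tail := nonprincipal_tail omegaU omegaN (i + m)%N.
have [j [/= ij hj]] := @filter_ex _ _ _ _ (filterI tail cT).
have mi : (i <= j)%N by apply: leq_trans ij; exact: leq_addr.
exists (j - i)%N; first by rewrite leq_subRL.
have := phiM (t ^+ (j - i))%g (t ^+ i)%g.
rewrite -expgnDr subnK // => h1.
rewrite -(nuUr (U := U) _ (phiU (t ^+ i)%g)) mulmxBl mul1mx.
have hij : nu (T j - T i) <= delta.
  rewrite [delta]splitr; apply: nu_trans (ltW hj) _.
  by apply: nu_sym; exact: ltW.
exact: nu_trans (nu_sym h1) hij.
Qed.

(** Conjugating [x] by a power of [t] whose image is close to 1 hardly moves [phi x], while the
    conjugate commutes with [y]. *)
Lemma displaced_commutator_near_one (t x y : G) m :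
  (forall n, (m <= n)%N -> commute (x ^ (t ^+ n))%g y) ->
  nu (phi [~ x, y]%g - 1%:M) <= 13 * eps.
Proof.
move=> comm; apply/ler_addgt0Pr => d d0.
pose delta := d / 4; have d4 : 0 < delta by rewrite divr_gt0.
(* [b2] will bound the distance from [phi x'] to [phi x], and [b4] the commutation error of [phi x]
   and [phi y]. Three further uses of [phiM] and [delta = d / 4] give the total [13 * eps + d]. *)
pose b2 := eps + delta + (eps + eps + (eps + delta)).
pose b4 := b2 + (eps + eps + b2).
have -> : 13 * eps + d = eps + (eps + (eps + b4)).
  by rewrite /b4 /b2 /delta; field.
have [n mn near1] := power_near_one t m d4.
set s := (t ^+ n)%g in near1; pose x' := (x ^ s)%g.
have a2 := phiM x s; have a3 := phiM s x'.
rewrite -[(s * x')%g]conjgC in a3.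
have e1 := nu_trans (nu_sym a3) a2.
have e2 : nu (phi x' - phi x) <= b2.
  apply: (@nu_trans _ _ (phi s *m phi x')).
    rewrite -{1}[phi x']mul1mx -mulmxBl (nuUr _ (phiU x')).
    exact: nu_sym near1.
  apply: (nu_trans e1).
  by rewrite -{2}[phi x]mulmx1 -mulmxBr (nuUl _ (phiU x)).
have e3 : nu (phi x' *m phi y - phi y *m phi x') <= eps + eps.
  have a5 := phiM y x'; rewrite -(comm n mn : x' * y = y * x')%g in a5.
  exact: nu_trans (nu_sym (phiM x' y)) a5.
have e4 : nu (phi x *m phi y - phi y *m phi x) <= b4.
  apply: (@nu_trans _ _ (phi x' *m phi y)).
    rewrite -mulmxBl (nuUr _ (phiU y)); exact: nu_sym.
  by apply: (nu_trans e3); rewrite -mulmxBr (nuUl _ (phiU y)).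
have yxU : phi y *m phi x \is unitarymx := mul_unitarymx (phiU y) (phiU x).
rewrite -(nuUl (U := U) _ yxU) mulmxBr mulmx1.
set g := [~ x, y]%g.
apply: (@nu_trans _ _ (phi (y * x)%g *m phi g)).
  by rewrite -mulmxBl (nuUr _ (phiU g)); exact: nu_sym (phiM y x).
have a6 := phiM (y * x)%g g; rewrite -[(y * x * g)%g]commgC in a6.
exact: nu_trans (nu_sym a6) (nu_trans (phiM x y) e4).
Qed.

End Displacement.

(** * Norms invariant under the adjoint *)

Section Symmetrization.
Variables (R : realType) (U : normed_unitary R).
Local Notation k := (udim U).

(* Adjoint-invariant, and equal to the original norm on differences of unitary
   matrices: adjoint invariance of the norm costs no generality. *)
Definition sym_norm (A : 'M[R[i]]_k) : R :=
  Num.max (unorm A) (unorm (adjmx A)).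

Fact sym_normD A B : sym_norm (A + B) <= sym_norm A + sym_norm B.
Proof.
rewrite /sym_norm ge_max adjmxD; apply/andP; split.
  by apply: (le_trans (unormD _ _)); rewrite lerD // le_max lexx.
by apply: (le_trans (unormD _ _)); rewrite lerD // le_max lexx orbT.
Qed.

Fact sym_normZ (z : R[i]) A : sym_norm (z *: A) = normc z * sym_norm A.
Proof.
have z0 : 0 <= normc z by case: z => x y; exact: sqrtr_ge0.
rewrite /sym_norm adjmxZ !unormZ maxr_pMr //.
suff -> : normc (z^*) = normc z by [].
by case: z {z0} => x y /=; rewrite sqrrN.
Qed.

Fact sym_norm_eq0 A : sym_norm A = 0 -> A = 0.
Proof.
move=> A0; apply: nu_eq0; rewrite -A0 /sym_norm le_max.
by rewrite lexx.
Qed.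

Fact sym_normM A B : sym_norm (A *m B) <= sym_norm A * sym_norm B.
Proof.
rewrite /sym_norm ge_max adjmxM; apply/andP; split.
  by apply: (le_trans (unormM _ _)); rewrite ler_pM ?nu_ge0 // le_max lexx.
rewrite mulrC; apply: (le_trans (unormM _ _)).
by rewrite ler_pM ?nu_ge0 // le_max lexx orbT.
Qed.

Fact sym_norm_bi (u A v : 'M[R[i]]_k) : u \is unitarymx -> v \is unitarymx ->
  sym_norm (u *m A *m v) = sym_norm A.
Proof.
move=> uU vU; rewrite /sym_norm !adjmxM (unorm_bi A uU vU) mulmxA.
by rewrite (unorm_bi _ (adj_unitary vU) (adj_unitary uU)).
Qed.

Definition symmetrization : normed_unitary R :=
  NormedUnitary sym_normD sym_normZ sym_norm_eq0 sym_normM sym_norm_bi.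

Lemma sym_norm_adj A : sym_norm (adjmx A) = sym_norm A.
Proof. by rewrite /sym_norm adjmxK maxC. Qed.

(** Multiplying [v - u] by [u^*] on the left and [v^*] on the right gives [u^* - v^*], of the same
    norm by bi-invariance. *)
Lemma sym_norm_unitary_dist u v : u \is unitarymx -> v \is unitarymx ->
  sym_norm (u - v) = unorm (u - v).
Proof.
move=> uU vU; have uU' := adj_unitary uU; have vU' := adj_unitary vU.
rewrite /sym_norm; suff -> : unorm (adjmx (u - v)) = unorm (u - v).
  exact: maxxx.
rewrite [RHS]nu_distC -[RHS](unorm_bi _ uU' vU') mulmxBr mulmxBl.
rewrite -[adjmx u *m v *m _]mulmxA (mul_unitary_adj vU) mulmx1.
by rewrite (mul_adj_unitary uU) mul1mx adjmxB.
Qed.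

End Symmetrization.

(** * Stability criterion for an extension with displaceable kernel *)

Section StableGroups.
Variables (omega : set_system nat) (omegaU : UltraFilter omega).
Hypothesis omegaN : nonprincipal omega.
Variables (R : realType) (G : groupType) (N : set G) (t h : G).
Hypothesis N1 : N 1%g.
Hypothesis NM : forall x y, N x -> N y -> N (x * y)%g.
Hypothesis NV : forall x, N x -> N x^-1%g.
Hypothesis NJ : forall x g, N x -> N (x ^ g)%g.
Hypothesis comm_conj : forall i j, N [~ h ^ (t ^+ i), h ^ (t ^+ j)]%g.
Hypothesis gen : forall P : set G, (forall x y, P x -> P y -> P (x * y)%g) ->
  (forall x, P x -> P x^-1%g) -> P h -> P t -> forall g, P g.
Hypothesis Ncomm : forall g, N g -> exists x y, [/\ N x, N y & g = [~ x, y]%g].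
Hypothesis displaced : forall x y, N x -> N y ->
  exists m, forall n, (m <= n)%N -> commute (x ^ (t ^+ n))%g y.

Definition coset_rep (g : G) : G := xget 1%g [set y | N (g^-1 * y)%g].

Lemma coset_repP g : N (g^-1 * coset_rep g)%g.
Proof.
by rewrite /coset_rep; case: xgetP => // /(_ g); rewrite /= mulVg.
Qed.

(** Elements of the same coset have the same set of candidates, so [xget] makes the same choice for
    them. *)
Lemma coset_rep_right_invariant : right_invariant N coset_rep.
Proof.
move=> x c Nc; rewrite /coset_rep; congr xget; apply/seteqP; split=> y /=.
  by move=> Ny; have := NM Nc Ny; rewrite invgM -!mulgA mulVKg.
by move=> Ny; have := NM (NV Nc) Ny; rewrite invgM mulgA.
Qed.

(** In units of eps: passing to coset representatives moves [phi] by at most 14 = 1 + 13, and the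
    new defect is at most 43 = 1 + 3 * 14. Since 43 / 2000 < 1 / 46 the iteration applies and moves
    the map by 4 * 43, for a total of 186. *)
Lemma almost_hom_stable_sym (U : normed_unitary R)
    (phi : G -> 'M[R[i]]_(udim U)) eps :
  (forall A, @unorm R U (adjmx A) = unorm A) ->
  (forall g, phi g \is unitarymx) ->
  (forall g h, unorm (phi (g * h)%g - phi g *m phi h) <= eps) ->
  eps <= 2000^-1 ->
  exists psi : G -> 'M[R[i]]_(udim U),
    [/\ forall g, psi g \is unitarymx,
        forall g h, psi (g * h)%g = psi g *m psi h &
        forall g, unorm (phi g - psi g) <= 186 * eps].
Proof.
move=> nu_adj phiU phiM eps_small.
have eps0 : 0 <= eps := le_trans (nu_ge0 _) (phiM 1%g 1%g).
have Nsmall g : N g -> unorm (phi g - 1%:M) <= 13 * eps.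
  move=> /Ncomm[x [y [Nx Ny ->]]]; have [m disp] := displaced Nx Ny.
  exact: (displaced_commutator_near_one omegaU omegaN phiU phiM disp).
pose phi' g := phi (coset_rep g).
have near g : unorm (phi' g - phi g) <= 14 * eps.
  have h1 := phiM g (g^-1 * coset_rep g)%g; rewrite mulVKg in h1.
  have -> : 14 * eps = eps + 13 * eps by ring.
  apply: (nu_trans h1); rewrite -{2}[phi g]mulmx1 -mulmxBr (nuUl _ (phiU g)).
  exact: Nsmall (coset_repP g).
have phi'H : almost_hom N (43 * eps) phi'.
  split=> [g|x c Nc|x y]; first exact: phiU.
    by rewrite /phi' (coset_rep_right_invariant _ Nc).
  have -> : 43 * eps = 14 * eps + (eps + (14 * eps + 14 * eps)) by ring.
  apply: (nu_trans (near _)); apply: (nu_trans (phiM x y)).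
  apply: (@nu_trans _ _ (phi' x *m phi y)).
    by rewrite -mulmxBl (nuUr _ (phiU y)); exact: nu_sym (near x).
  by rewrite -mulmxBr (nuUl _ (phiU _)); exact: nu_sym (near y).
pose bseq i := (h ^ (t ^+ i))%g.
have bE i : bseq i = (h ^ (t ^+ i))%g by [].
have Mmean := mean_group_mean omegaU nu_adj t bseq.
have Minv :=
  group_mean_invariant omegaU omegaN nu_adj N1 NM NJ bE comm_conj gen.
have eps46 : 43 * eps <= 46^-1 by lra.
have [psi [psiU psiM psiphi]] :=
  almost_hom_near_hom omegaU omegaN nu_adj NJ Mmean Minv phi'H eps46.
exists psi; split=> // g.
have -> : 186 * eps = 14 * eps + 4 * (43 * eps) by ring.
exact: nu_trans (nu_sym (near g)) (nu_sym (psiphi g)).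
Qed.

Lemma almost_hom_stable (U : normed_unitary R) (phi : G -> unitary R (udim U))
    eps :
  (forall g h,
    unorm (val (phi (g * h)%g) - val (phi g) *m val (phi h)) <= eps) ->
  eps <= 2000^-1 ->
  exists psi : {multiplicative G -> unitary R (udim U)},
    forall g, unorm (val (phi g) - val (psi g)) <= 186 * eps.
Proof.
move=> phiM eps_small.
pose U' := symmetrization U.
pose f g : 'M[R[i]]_(udim U') := val (phi g).
have fU g : f g \is unitarymx := valP (phi g).
have fM x y : @unorm R U' (f (x * y)%g - f x *m f y) <= eps.
  rewrite [unorm _]sym_norm_unitary_dist ?phiM //.
  exact: (mul_unitarymx (fU x) (fU y)).
have [psi [psiU psiM psif]] :=
  @almost_hom_stable_sym U' f eps (@sym_norm_adj R U) fU fM eps_small.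
pose p g : unitary R (udim U) := exist _ (psi g) (psiU g).
have pM : {morph p : x y / (x * y)%g}.
  by move=> x y; apply: val_inj; exact: psiM.
pose P : {multiplicative G -> unitary R (udim U)} :=
  HB.pack p (isMultiplicative.Build G (unitary R (udim U)) p pM).
exists P => g; have := psif g.
by rewrite [unorm _]sym_norm_unitary_dist.
Qed.

Theorem displaced_extension_stable (UU : set (normed_unitary R)) :
  uniformly_stable_linear G omega UU.
Proof.
move=> U phi [_ def0].
have bound n x y : unorm (val (phi n (x * y)%g) -
    val (phi n x) *m val (phi n y)) <= defect (phi n).
  rewrite /defect; apply: ub_le_sup; last by exists x => //; exists y.
  exists (2 * @unorm R (U n) 1%:M) => _ [x' _ [y' _ <-]].
  apply: (le_trans (nuB _ _)).
  rewrite (nuU (valP (phi n (x' * y')%g))).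
  rewrite (nuU (mul_unitarymx (valP (phi n x')) (valP (phi n y')))); lra.
have ex n : exists psi : {multiplicative G -> unitary R (udim (U n))},
    defect (phi n) <= 2000^-1 ->
    forall g, unorm (val (phi n g) - val (psi g)) <= 186 * defect (phi n).
  have [small|large] := leP (defect (phi n)) 2000^-1.
    by have [psi ?] := almost_hom_stable (bound n) small; exists psi.
  (* Where the defect is large the trivial homomorphism will do, as such indices stay outside the
     set [S] below. *)
  by exists (@one_fun G (unitary R (udim (U n)))).
pose psi n := sval (cid (ex n)); have psiP n := svalP (cid (ex n)).
exists psi, 186; first by lra.
(* This set contains a tail of the natural numbers, hence belongs to [omega]. *)
exists [set n | defect (phi n) <= 2000^-1].
  have pos : (0 : R) < 2000^-1 by rewrite invr_gt0 ltr0n.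
  have /cvgrPdist_lt/(_ _ pos)[m _ mP] := def0.
  apply: filterS (nonprincipal_tail omegaU omegaN m) => n /= mn.
  have := mP n mn; rewrite /= sub0r normrN => /ltW.
  exact: le_trans (ler_norm _).
move=> n small; rewrite /udist; apply: sup_le_ub.
  by exists (unorm (val (phi n 1%g) - val (psi n 1%g))); exists 1%g.
by move=> _ [g _ <-]; exact: psiP.
Qed.

End StableGroups.

(** * Generated subgroups of permutation groups *)

Record bijection (X : Type) := Bijection {
  bij_fun :> X -> X;
  bij_inv : X -> X;
  bij_funK : cancel bij_fun bij_inv;
  bij_invK : cancel bij_inv bij_fun }.

(** The stored inverse is determined by the function. *)
Lemma bijection_ext (X : Type) (p q : bijection X) : p =1 q -> p = q.
Proof.
case: p q => [f f' fK f'K] [g g' gK g'K] /= /funext fg.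
have fg' : f' = g'.
  by apply/funext => x; rewrite -{1}(g'K x) -fg fK.
by subst g g'; congr Bijection; exact: Prop_irrelevance.
Qed.

HB.instance Definition _ (X : Type) := gen_eqMixin (bijection X).
HB.instance Definition _ (X : Type) := gen_choiceMixin (bijection X).

Section BijectionGroup.
Variable X : Type.
Implicit Types p q : bijection X.

Definition bij_one : bijection X :=
  @Bijection X id id (fun=> erefl) (fun=> erefl).

Definition bij_mul p q : bijection X :=
  Bijection (can_comp (bij_funK p) (bij_funK q))
            (can_comp (bij_invK q) (bij_invK p)).

Definition bij_opp p : bijection X := Bijection (bij_invK p) (bij_funK p).

Fact bij_mulA : associative bij_mul.
Proof. by move=> p q r; exact: bijection_ext. Qed.

Fact bij_mul1 : left_id bij_one bij_mul.
Proof. by move=> p; exact: bijection_ext. Qed.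

Fact bij_mulr1 : right_id bij_one bij_mul.
Proof. by move=> p; exact: bijection_ext. Qed.

Fact bij_mulV : left_inverse bij_one bij_opp bij_mul.
Proof. by move=> p; apply: bijection_ext => x; exact: bij_funK. Qed.

Fact bij_mulrV : right_inverse bij_one bij_opp bij_mul.
Proof. by move=> p; apply: bijection_ext => x; exact: bij_invK. Qed.

HB.instance Definition _ := isGroup.Build (bijection X)
  bij_mulA bij_mul1 bij_mulr1 bij_mulV bij_mulrV.

Lemma bijM p q x : (p * q)%g x = p (q x). Proof. by []. Qed.
Lemma bij1 x : (1%g : bijection X) x = x. Proof. by []. Qed.
Lemma bijV p x : p^-1%g (p x) = x. Proof. exact: bij_funK. Qed.
Lemma bijVr p x : p (p^-1%g x) = x. Proof. exact: bij_invK. Qed.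

End BijectionGroup.

(** * Subgroup generated by two elements *)

Section GeneratedGroup.
Variables (S : groupType) (h t : S).

(** An intersection of closed sets, so that the definition is itself the induction principle; the
    identity arises as [h * h^-1]. *)
Definition generated (p : S) : Prop := forall H : set S,
  (forall x y, H x -> H y -> H (x * y)%g) -> (forall x, H x -> H x^-1%g) ->
  H h -> H t -> H p.

Lemma generatedM x y : generated x -> generated y -> generated (x * y)%g.
Proof.
by move=> gx gy H HM HV Hh Ht; apply: (HM); [exact: gx|exact: gy].
Qed.

Lemma generatedV x : generated x -> generated x^-1%g.
Proof. by move=> gx H HM HV Hh Ht; apply: (HV); exact: gx. Qed.

Lemma generated_h : generated h. Proof. by []. Qed.
Lemma generated_t : generated t. Proof. by []. Qed.

Lemma generated1 : generated 1%g.
Proof. by rewrite -(mulgV h); apply: generatedM => //; exact: generatedV. Qed.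

Lemma generatedX x n : generated x -> generated (x ^+ n)%g.
Proof.
move=> gx; elim: n => [|n IH]; first by rewrite expg0; exact: generated1.
by rewrite expgS; exact: generatedM.
Qed.

Lemma generatedJ x y : generated x -> generated y -> generated (x ^ y)%g.
Proof.
move=> gx gy; rewrite conjgE.
by apply: generatedM; [exact: generatedV|exact: generatedM].
Qed.

Lemma generatedR x y : generated x -> generated y -> generated [~ x, y]%g.
Proof.
move=> gx gy; rewrite commgEl.
by apply: generatedM; [exact: generatedV|exact: generatedJ].
Qed.

Definition generated_pred : pred S := fun p => `[< generated p >].

Record generated_group := GeneratedGroup {
  generated_val : S;
  _ : generated_pred generated_val }.

HB.instance Definition _ := [isSub for generated_val].
HB.instance Definition _ := [Choice of generated_group by <:].

Fact generated_closed : group_closed generated_pred.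
Proof.
split=> [|x y]; rewrite !unfold_in /generated_pred !asboolE.
  exact: generated1.
move=> gx gy.
by apply: generatedM => //; exact: generatedV.
Qed.

HB.instance Definition _ :=
  SubChoice_isSubGroup.Build S generated_pred generated_group generated_closed.

End GeneratedGroup.

(** * Stability of a two-generator subgroup *)

Section GeneratedGroupStable.
Variables (S : groupType) (h t : S).
Local Notation G := (generated_group h t).
Local Notation gval := (@generated_val S h t).

Let gvalM (x y : G) : gval (x * y)%g = (gval x * gval y)%g.
Proof. exact: (valM x y). Qed.

Let gval_inj : injective gval.
Proof. exact: val_inj. Qed.

Let gval1 : gval 1%g = 1%g.
Proof. exact: val1. Qed.

Let gvalV (x : G) : gval x^-1%g = (gval x)^-1%g.
Proof. by apply: (mulgI (gval x)); rewrite -gvalM !mulgV gval1. Qed.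

Let gvalX (x : G) n : gval (x ^+ n)%g = (gval x ^+ n)%g.
Proof. by elim: n => [|n IH]; rewrite ?expg0 // !expgS gvalM IH. Qed.

Let gvalJ (x y : G) : gval (x ^ y)%g = (gval x ^ gval y)%g.
Proof. by rewrite !conjgE !gvalM gvalV. Qed.

Let gvalR (x y : G) : gval [~ x, y]%g = [~ gval x, gval y]%g.
Proof. by rewrite !commgEl gvalM gvalV gvalJ. Qed.

Definition generated_elt (p : S) (gp : generated h t p) : G :=
  GeneratedGroup (introT (asboolP _) gp).

Lemma generated_valP (x : G) : generated h t (gval x).
Proof. by apply/asboolP; exact: (valP x). Qed.

(** The definition of [generated] is applied to the image of [P] in [S]. *)
Lemma generated_group_ind (P : set G) :
  (forall x y, P x -> P y -> P (x * y)%g) -> (forall x, P x -> P x^-1%g) ->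
  P (generated_elt (@generated_h S h t)) ->
  P (generated_elt (@generated_t S h t)) ->
  forall g, P g.
Proof.
move=> PM PV Ph Pt g.
have [x Px xg] : [set p | exists2 x : G, P x & gval x = p] (gval g).
  apply: (generated_valP g) => [_ _ [x Px <-] [y Py <-]|_ [x Px <-]||].
  - by exists (x * y)%g; [exact: PM|exact: gvalM].
  - by exists x^-1%g; [exact: PV|exact: gvalV].
  - by exists (generated_elt (@generated_h S h t)).
  - by exists (generated_elt (@generated_t S h t)).
by rewrite -(val_inj xg).
Qed.

Lemma generated_group_3_generated : n_generated 3 G.
Proof.
(* The two generators, padded with the identity. *)
exists [tuple generated_elt (@generated_h S h t);
  generated_elt (@generated_t S h t); 1%g] => H Hcl sub g; rewrite inE.
have HM := group_closedM Hcl; have HV := group_closedV Hcl.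
apply: (@generated_group_ind [set x | x \in H]) => /=.
- by move=> x y; exact: HM.
- by move=> x; exact: HV.
- by apply: sub; rewrite !inE eqxx.
- by apply: sub; rewrite !inE eqxx orbT.
Qed.

Variables (omega : set_system nat) (omegaU : UltraFilter omega).
Hypothesis omegaN : nonprincipal omega.
Variable N : set S.
Hypothesis N1 : N 1%g.
Hypothesis NM : forall x y, N x -> N y -> N (x * y)%g.
Hypothesis NV : forall x, N x -> N x^-1%g.
Hypothesis NJ : forall x g, N x -> generated h t g -> N (x ^ g)%g.
Hypothesis Ngen : forall x, N x -> generated h t x.
Hypothesis comm_conj : forall i j, N [~ h ^ (t ^+ i), h ^ (t ^+ j)]%g.
Hypothesis Ncomm : forall g, N g -> exists x y, [/\ N x, N y & g = [~ x, y]%g].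
Hypothesis displaced : forall x y, N x -> N y ->
  exists m, forall n, (m <= n)%N -> commute (x ^ (t ^+ n))%g y.

Lemma generated_group_stable (R : realType) (UU : set (normed_unitary R)) :
  uniformly_stable_linear G omega UU.
Proof.
apply: (@displaced_extension_stable omega omegaU omegaN R G
  [set x | N (gval x)] (generated_elt (@generated_t S h t))
  (generated_elt (@generated_h S h t))).
- by have := N1; rewrite -gval1.
- by move=> x y Nx Ny; rewrite /mkset gvalM; exact: NM.
- by move=> x Nx; rewrite /mkset gvalV; exact: NV.
- move=> x g Nx; rewrite /mkset gvalJ; apply: NJ => //.
  exact: generated_valP.
- by move=> i j; rewrite /mkset gvalR !gvalJ !gvalX; exact: comm_conj.
- by move=> P PM PV Ph Pt; exact: generated_group_ind.
- move=> g /Ncomm[x [y [Nx Ny gE]]].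
  exists (generated_elt (Ngen Nx)), (generated_elt (Ngen Ny)); split=> //.
  by apply: gval_inj; rewrite gvalR; exact: gE.
- move=> x y Nx Ny; have [m disp] := displaced Nx Ny.
  exists m => n /disp xy; apply: gval_inj.
  by rewrite (gvalM (x ^ _)%g y) (gvalM y) gvalJ gvalX.
Qed.

End GeneratedGroupStable.

(** * Groups in which every element is a commutator *)

Section Tower.
Variable Y : Type.
Local Notation X := (Y * (nat -> int))%type.
Implicit Types (p q : bijection X) (x : X).

(** Level n is a copy of Y x Z^n. Level n + 1 consists of copies of level n indexed by Z, which is
    the room that the swindle needs. *)
Definition level (n : nat) : set X :=
  [set x | forall j, (n <= j)%N -> x.2 j = 0].

Definition supported n p := forall x, ~ level n x -> p x = x.

Definition tower p := exists n, supported n p.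

Lemma level_mono m n x : (m <= n)%N -> level m x -> level n x.
Proof. by move=> mn lx j nj; apply: lx; exact: leq_trans nj. Qed.

Lemma supported_mono m n p : (m <= n)%N -> supported m p -> supported n p.
Proof. by move=> mn sp x nx; apply: sp => /(level_mono mn). Qed.

(** A point sent outside the level would be sent to a fixed point of [p], hence equal it by
    injectivity. *)
Lemma supported_level n p x : supported n p -> level n x -> level n (p x).
Proof.
move=> sp lx; apply: contrapT => nl; apply: (nl).
by have := bijV p (p x); rewrite (sp _ nl) bijV => <-.
Qed.

Lemma supportedV n p : supported n p -> supported n p^-1%g.
Proof. by move=> sp x /sp px; rewrite -{1}px bijV. Qed.

Lemma tower1 : tower 1%g.
Proof. by exists 0%N. Qed.

Lemma towerV p : tower p -> tower p^-1%g.
Proof. by move=> [n sp]; exists n; exact: supportedV. Qed.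

Lemma towerM p q : tower p -> tower q -> tower (p * q)%g.
Proof.
move=> [m sp] [n sq]; exists (maxn m n) => x nx.
rewrite bijM (supported_mono (leq_maxr m n) sq nx).
exact: (supported_mono (leq_maxl m n) sp nx).
Qed.

Definition set_coord i (z : int) x : X :=
  (x.1, fun j => if j == i then z else x.2 j).

Lemma set_coord_set i z w x : set_coord i z (set_coord i w x) = set_coord i z x.
Proof. by congr (_, _); apply/funext => j /=; case: eqP. Qed.

Lemma set_coord_id i x : set_coord i (x.2 i) x = x.
Proof.
by case: x => y f; congr (_, _); apply/funext => j /=; case: eqP => // ->.
Qed.

Lemma set_coord_at i z x : (set_coord i z x).2 i = z.
Proof. by rewrite /= eqxx. Qed.

Lemma level_set_coord i z x : level i.+1 x -> level i.+1 (set_coord i z x).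
Proof. by move=> lx j ij /=; rewrite gtn_eqF // lx. Qed.

Lemma level_set_coord0 i x : level i.+1 x -> level i (set_coord i 0 x).
Proof.
move=> lx j ij /=; case: eqP => // /eqP ji.
by rewrite lx // ltn_neqAle eq_sym ji.
Qed.

Lemma level_coord i x : level i x -> x.2 i = 0.
Proof. by apply. Qed.

Definition translate_fun i (z : int) x : X :=
  if `[< level i.+1 x >] then set_coord i (x.2 i + z) x else x.

Fact translate_funK i z : cancel (translate_fun i z) (translate_fun i (- z)).
Proof.
move=> x; rewrite /translate_fun; have [lx|nx] := asboolP (level i.+1 x).
  rewrite asboolT; last exact: level_set_coord.
  by rewrite set_coord_at set_coord_set addrK set_coord_id.
by rewrite asboolF.
Qed.

Fact translate_funVK i z : cancel (translate_fun i (- z)) (translate_fun i z).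
Proof. by move=> x; rewrite -{1}[z]opprK translate_funK. Qed.

Definition translate i : bijection X :=
  Bijection (@translate_funK i 1) (@translate_funVK i 1).

Lemma translate_supported i : supported i.+1 (translate i).
Proof. by move=> x nx; rewrite /= /translate_fun asboolF. Qed.

(* [p], which lives where coordinate [i] vanishes, is copied to all
   nonnegative values of that coordinate. *)
Definition copies_fun i p x : X :=
  if `[< level i.+1 x /\ 0 <= x.2 i >]
  then set_coord i (x.2 i) (p (set_coord i 0 x)) else x.

Lemma copies_funK i p q : supported i p -> supported i q -> cancel p q ->
  cancel (copies_fun i p) (copies_fun i q).
Proof.
move=> sp sq pq x; rewrite /copies_fun.
have [[lx x0]|nx] := asboolP (level i.+1 x /\ 0 <= x.2 i); last first.
  by rewrite asboolF.
have lp := supported_level sp (level_set_coord0 lx).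
rewrite asboolT ?set_coord_at ?set_coord_set; last first.
  by split=> //; apply: level_set_coord; exact: level_mono lp.
have -> : set_coord i 0 (p (set_coord i 0 x)) = p (set_coord i 0 x).
  by rewrite -{1}(level_coord lp) set_coord_id.
by rewrite pq set_coord_set set_coord_id.
Qed.

(* The swindle: [p] is the quotient of its copies at coordinates [>= 0] by its
   copies at coordinates [>= 1]. *)
Lemma tower_commutator p : tower p ->
  exists a b, [/\ tower a, tower b & p = [~ a, b]%g].
Proof.
move=> [i sp]; have sp' := supportedV sp.
pose d := Bijection (copies_funK sp sp' (bijV p))
  (copies_funK sp' sp (bijVr p)).
have ds : supported i.+1 d.
  by move=> x nx; rewrite /= /copies_fun asboolF // => -[].
have dT y : level i.+1 y -> 0 <= y.2 i ->
    d y = set_coord i (y.2 i) (p (set_coord i 0 y)).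
  by move=> ly y0; rewrite /= /copies_fun asboolT.
have dF y : y.2 i < 0 -> d y = y.
  by move=> y0; rewrite /= /copies_fun asboolF // => -[_]; rewrite leNgt y0.
have sT y : level i.+1 y -> translate i y = set_coord i (y.2 i + 1) y.
  by move=> ly; rewrite /= /translate_fun asboolT.
have pfix y : y.2 i <> 0 -> p y = y by move=> y0; apply: (sp) => /level_coord.
(* The two sides are compared by coordinate [i]. From 0 on, [p] fixes the translated point; at -1,
   [p] does what the copy at 0 does; below -1 both sides only translate. *)
have key : (p * translate i * d)%g = (d * translate i)%g.
  apply: bijection_ext => x; rewrite !bijM.
  have [lx|nx] := pselect (level i.+1 x); last first.
    rewrite (ds _ nx) (translate_supported nx) (ds _ nx).
    by apply: (sp) => /(level_mono (leqnSn i)).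
  have lS z : level i.+1 (set_coord i z x) by exact: level_set_coord.
  have lp : level i (p (set_coord i 0 x)).
    exact: (supported_level sp (level_set_coord0 lx)).
  have lp' z : level i.+1 (set_coord i z (p (set_coord i 0 x))).
    by apply: level_set_coord; exact: level_mono lp.
  rewrite [in RHS](sT x lx).
  have [x0|x0] := leP 0 (x.2 i).
    rewrite (dT x lx x0) (sT _ (lp' _)) dT ?set_coord_at //; last by lia.
    by rewrite !set_coord_set pfix // set_coord_at; lia.
  rewrite (dF x x0) (sT x lx).
  have [xm|xm] := eqVneq (x.2 i) (-1).
    rewrite xm addNr dT ?set_coord_at // set_coord_set.
    by rewrite -[X in set_coord i X (p _)](level_coord lp) set_coord_id.
  rewrite dF ?set_coord_at; last by lia.
  by rewrite pfix // set_coord_at; lia.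
exists d^-1%g, (translate i)^-1%g; split.
- by exists i.+1; exact: supportedV.
- by exists i.+1; apply: supportedV; exact: translate_supported.
rewrite commgEl conjgE !invgK; apply: (mulIg (translate i)); apply: (mulIg d).
by rewrite key !mulgA mulgVK mulgVK.
Qed.

End Tower.

(** * Countable subgroups closed under commutator roots *)

Section CommutatorClosure.
Variables (B : groupType) (T : set B).
Hypothesis T1 : T 1%g.
Hypothesis TM : forall x y, T x -> T y -> T (x * y)%g.
Hypothesis TV : forall x, T x -> T x^-1%g.
Hypothesis Tcomm : forall x, T x -> exists a b, [/\ T a, T b & x = [~ a, b]%g].

(* Skolemize [Tcomm] and evaluate all terms built from the [e n], products,
   inverses and the two Skolem functions. *)
Lemma countable_commutator_closure (e : nat -> B) : (forall n, T (e n)) ->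
  exists k : nat -> B,
  [/\ forall n, range k (e n),
      forall x y, range k x -> range k y -> range k (x * y)%g,
      forall x, range k x -> range k x^-1%g &
      forall x, range k x -> exists a b,
        [/\ range k a, range k b & x = [~ a, b]%g]].
Proof.
move=> eT.
have ex x : exists ab : B * B,
    T x -> [/\ T ab.1, T ab.2 & x = [~ ab.1, ab.2]%g].
  have [Tx|nTx] := pselect (T x); last by exists (1%g, 1%g).
  by have [a [b ?]] := Tcomm Tx; exists (a, b).
have [w wP] := choice ex.
(* Labels 0 to 3 stand for product, inverse and the two components of [w]; malformed trees evaluate
   to 1. *)
pose ev := fix ev (s : GenTree.tree nat) : B :=
  match s with
  | GenTree.Leaf n => e n
  | GenTree.Node 0 [:: s1; s2] => (ev s1 * ev s2)%g
  | GenTree.Node 1 [:: s1] => (ev s1)^-1%g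
  | GenTree.Node 2 [:: s1] => (w (ev s1)).1
  | GenTree.Node 3 [:: s1] => (w (ev s1)).2
  | _ => 1%g
  end.
have evT s : T (ev s).
  elim: s => [n|n f IH] /=; first exact: eT.
  case: n f IH => [|[|[|[|n]]]] [|s1 [|s2 [|s3 f]]] //= IH.
  - by apply: TM; case: IH => // ? [].
  - by apply: TV; case: IH.
  - by have [] := wP (ev s1) IH.1.
  - by have [] := wP (ev s1) IH.1.
(* Trees over [nat] are countable, so [k] enumerates all values of [ev]. *)
pose k n := if unpickle n is Some s then ev s else 1%g.
have evk s : range k (ev s) by exists (pickle s) => //; rewrite /k pickleK.
have kev x : range k x -> exists s, x = ev s.
  move=> [n _ <-]; rewrite /k; case: (unpickle n) => [s|]; first by exists s.
  by exists (GenTree.Node 0 [::]).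
exists k; split.
- by move=> n; exact: (evk (GenTree.Leaf n)).
- move=> _ _ /kev[s ->] /kev[s' ->].
  exact: (evk (GenTree.Node 0 [:: s; s'])).
- by move=> _ /kev[s ->]; exact: (evk (GenTree.Node 1 [:: s])).
- move=> _ /kev[s ->]; have [_ _ ?] := wP (ev s) (evT s).
  exists (w (ev s)).1, (w (ev s)).2; split=> //.
  + exact: (evk (GenTree.Node 2 [:: s])).
  + exact: (evk (GenTree.Node 3 [:: s])).
Qed.

End CommutatorClosure.

(** * The generated group *)

Section Wreath.
Variables (X : Type) (k : nat -> bijection X).
Hypothesis kM : forall x y, range k x -> range k y -> range k (x * y)%g.
Hypothesis kV : forall x, range k x -> range k x^-1%g.
Hypothesis kcomm : forall x, range k x -> exists a b,
  [/\ range k a, range k b & x = [~ a, b]%g].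

Local Notation W := (bijection (int * X)).

Lemma range1 : range k 1%g.
Proof.
by rewrite -(mulgV (k 0%N)); apply: kM; [exists 0%N|apply: kV; exists 0%N].
Qed.

Lemma rangeR x y : range k x -> range k y -> range k [~ x, y]%g.
Proof.
by move=> kx ky; apply: (kM (kV kx)); apply: (kM (kV ky)); exact: kM.
Qed.

Lemma rangeJ x y : range k x -> range k y -> range k (x ^ y)%g.
Proof. by move=> kx ky; apply: (kM (kV ky)); exact: kM. Qed.

Fact fiberwise_funK (f : int -> bijection X) :
  cancel (fun x : int * X => (x.1, f x.1 x.2))
         (fun x => (x.1, (f x.1)^-1%g x.2)).
Proof. by move=> [n x]; congr pair; exact: bij_funK. Qed.

Fact fiberwise_invK (f : int -> bijection X) :
  cancel (fun x : int * X => (x.1, (f x.1)^-1%g x.2))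
         (fun x => (x.1, f x.1 x.2)).
Proof. by move=> [n x]; congr pair; exact: bij_invK. Qed.

(** The unrestricted product of Z copies of the permutation group of [X], acting on Z x X. *)
Definition fiberwise f : W := Bijection (@fiberwise_funK f) (@fiberwise_invK f).

Lemma fiberwiseE f (x : int * X) : fiberwise f x = (x.1, f x.1 x.2).
Proof. by []. Qed.

Lemma fiberwiseM f g :
  (fiberwise f * fiberwise g)%g = fiberwise (fun n => f n * g n)%g.
Proof. by apply: bijection_ext => -[n x]. Qed.

Lemma fiberwise1 : fiberwise (fun=> 1%g) = 1%g.
Proof. by apply: bijection_ext => -[n x]. Qed.

Lemma fiberwiseV f : (fiberwise f)^-1%g = fiberwise (fun n => (f n)^-1)%g.
Proof. by apply: bijection_ext => -[n x]. Qed.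

Lemma fiberwiseJ f g :
  (fiberwise f ^ fiberwise g)%g = fiberwise (fun n => f n ^ g n)%g.
Proof. by apply: bijection_ext => -[n x]. Qed.

Lemma fiberwiseR f g :
  [~ fiberwise f, fiberwise g]%g = fiberwise (fun n => [~ f n, g n])%g.
Proof. by apply: bijection_ext => -[n x]. Qed.

Lemma eq_fiberwise f g : f =1 g -> fiberwise f = fiberwise g.
Proof. by move=> /funext ->. Qed.

Fact zshiftK :
  cancel (fun x : int * X => (x.1 + 1, x.2)) (fun x => (x.1 - 1, x.2)).
Proof. by move=> [n x] /=; rewrite addrK. Qed.

Fact zshift_invK :
  cancel (fun x : int * X => (x.1 - 1, x.2)) (fun x => (x.1 + 1, x.2)).
Proof. by move=> [n x] /=; rewrite subrK. Qed.

Definition zshift : W := Bijection zshiftK zshift_invK.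

Lemma zshiftX m (x : int * X) : (zshift ^+ m)%g x = (x.1 + m%:Z, x.2).
Proof.
elim: m x => [|m IH] [n x]; first by rewrite expg0 bij1 addr0.
by rewrite expgSr bijM IH /= -addrA -intS.
Qed.

Lemma zshiftXV m (x : int * X) : (zshift ^+ m)^-1%g x = (x.1 - m%:Z, x.2).
Proof.
by rewrite -{1}[x](_ : (zshift ^+ m)%g (x.1 - m%:Z, x.2) = x) ?bijV //
  zshiftX /= subrK -surjective_pairing.
Qed.

Lemma fiberwise_zshiftJ f m :
  (fiberwise f ^ (zshift ^+ m))%g = fiberwise (fun n => f (n + m%:Z)).
Proof.
apply: bijection_ext => -[n x]; rewrite conjgE !bijM.
rewrite zshiftX fiberwiseE zshiftXV /=.
by rewrite addrK.
Qed.

Lemma fiberwise_zshiftVJ f m :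
  (fiberwise f ^ (zshift ^+ m)^-1)%g = fiberwise (fun n => f (n - m%:Z)).
Proof.
apply: bijection_ext => -[n x]; rewrite conjgE !bijM.
rewrite invgK zshiftXV fiberwiseE zshiftX /=.
by rewrite subrK.
Qed.

(* [k i] sits at position [2 ^ i]: differences of distinct powers of 2 determine
   the powers, so two distinct translates meet in at most one position. *)
Definition sparse (n : int) : bijection X :=
  if n is Posz m then
    if m == (2 ^ trunc_log 2 m)%N then k (trunc_log 2 m) else 1%g
  else 1%g.

Lemma sparse_pow i : sparse (2 ^ i)%N = k i.
Proof. by rewrite /sparse trunc_expnK // eqxx. Qed.

Lemma sparse_neq1 n : sparse n <> 1%g -> exists i, n = (2 ^ i)%N.
Proof. by case: n => // m /=; case: eqP => // -> _; eexists. Qed.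

Lemma range_sparse n : range k (sparse n).
Proof.
case: n => [m|m] /=; last exact: range1.
by case: eqP => _; [eexists|exact: range1].
Qed.

(** The restricted product N of copies of the countable group [range k]. *)
Definition fin_fiberwise (p : W) : Prop :=
  exists f, [/\ forall n, range k (f n),
    exists m : nat, forall n : int, (m <= `|n|)%N -> f n = 1%g &
    p = fiberwise f].

Local Notation h := (fiberwise sparse).
Local Notation Gen := (generated h zshift).

Lemma fin_fiberwise1 : fin_fiberwise 1%g.
Proof.
exists (fun=> 1%g); split; [by move=> _; exact: range1|by exists 0%N|].
by rewrite fiberwise1.
Qed.

Lemma fin_fiberwiseM x y : fin_fiberwise x -> fin_fiberwise y ->
  fin_fiberwise (x * y)%g.
Proof.
move=> [f [fk [m fm] ->]] [g [gk [m' gm] ->]].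
exists (fun n => f n * g n)%g; split.
- by move=> n; exact: kM.
- exists (maxn m m') => n; rewrite geq_max => /andP[mn m'n].
  by rewrite fm // gm // mulg1.
- exact: fiberwiseM.
Qed.

Lemma fin_fiberwiseV x : fin_fiberwise x -> fin_fiberwise x^-1%g.
Proof.
move=> [f [fk [m fm] ->]].
exists (fun n => (f n)^-1%g); split.
- by move=> n; exact: kV.
- by exists m => n mn; rewrite fm // invg1.
- exact: fiberwiseV.
Qed.

Lemma fin_fiberwiseJ x g : fin_fiberwise x -> Gen g -> fin_fiberwise (x ^ g)%g.
Proof.
(* Conjugation by [g^-1] is included to make the predicate closed under inverses. *)
move=> Nx Gg; pose P := [set g | forall x, fin_fiberwise x ->
  fin_fiberwise (x ^ g)%g /\ fin_fiberwise (x ^ g^-1)%g].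
suff PG : P g by case: (PG x Nx).
apply: (Gg P); rewrite /P /=.
- move=> a b Ha Hb y Ny; rewrite invgM !conjgM; split.
    exact: (Hb _ (Ha _ Ny).1).1.
  exact: (Ha _ (Hb _ Ny).2).2.
- by move=> a Ha y Ny; rewrite invgK; have [] := Ha y Ny.
- move=> y [f [fk [m fm] ->]]; split.
    rewrite fiberwiseJ; exists (fun n => f n ^ sparse n)%g; split=> //.
      by move=> n; apply: rangeJ => //; exact: range_sparse.
    by exists m => n mn; rewrite fm // conj1g.
  rewrite fiberwiseV fiberwiseJ.
  exists (fun n => f n ^ (sparse n)^-1)%g; split=> //.
    by move=> n; apply: rangeJ => //; apply: kV; exact: range_sparse.
  by exists m => n mn; rewrite fm // conj1g.
- move=> y [f [fk [m fm] ->]]; rewrite -[zshift]expg1; split.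
    rewrite fiberwise_zshiftJ; exists (fun n => f (n + 1%:Z)); split=> //.
    by exists m.+1 => n mn; apply: fm; lia.
  rewrite fiberwise_zshiftVJ; exists (fun n => f (n - 1%:Z)); split=> //.
  by exists m.+1 => n mn; apply: fm; lia.
Qed.

Definition single (j : int) (p : bijection X) : W :=
  fiberwise (fun n => if n == j then p else 1%g).

(** Distinct powers of 2 differ by a factor of at least 2; once all exponents are compared, this
    makes every case linear. *)
Lemma pow2_diff_inj (i j u v : nat) : i <> j ->
  (2 ^ u + 2 ^ j = 2 ^ v + 2 ^ i)%N -> u = i /\ v = j.
Proof.
have mono (a b : nat) : (a < b)%N -> (2 * 2 ^ a <= 2 ^ b)%N.
  by move=> ab; rewrite -expnS leq_exp2l.
have pos (a : nat) : (0 < 2 ^ a)%N by rewrite expn_gt0.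
move=> ij E.
have lt_case (a b : nat) :
    [\/ (2 * 2 ^ a <= 2 ^ b)%N, (2 * 2 ^ b <= 2 ^ a)%N | a = b].
  by case: (ltngtP a b) => [/mono|/mono|] ?;
    [constructor 1|constructor 2|constructor 3].
have p1 := pos u; have p2 := pos v; have p3 := pos i; have p4 := pos j.
have [ij'|ij'|//] := lt_case i j; have [uv|uv|uv] := lt_case u v.
all: have [ui|ui|ui] := lt_case u i; have [vj|vj|vj] := lt_case v j.
all: try by split.
all: by exfalso; subst => //; lia.
Qed.

(** Write [p] as the commutator of [k i] and [k j]. The translates of [h] by 2^i and 2^j carry these
    two entries at position 0 and overlap nowhere else, so their commutator is [p] at 0. *)
Lemma generated_single0 p : range k p -> Gen (single 0 p).
Proof.
move=> /kcomm[a [b [[i _ ia] [j _ jb] ->]]].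
have [ij|/eqP ij] := eqVneq i j.
  have -> : single 0 [~ a, b]%g = 1%g.
    rewrite -fiberwise1; apply: eq_fiberwise => n.
    by case: eqP => // _; rewrite -ia -jb ij commgg.
  exact: generated1.
suff -> : single 0 [~ a, b]%g =
    [~ h ^ (zshift ^+ (2 ^ i)), h ^ (zshift ^+ (2 ^ j))]%g.
  apply: generatedR; apply: generatedJ; try exact: generated_h.
  - by apply: generatedX; exact: generated_t.
  - by apply: generatedX; exact: generated_t.
rewrite !fiberwise_zshiftJ fiberwiseR; apply: eq_fiberwise => n.
case: eqP => [->|n0]; first by rewrite !add0r !sparse_pow ia jb.
apply/esym/eqP/contraT => /eqP neq1; exfalso.
have s1 : sparse (n + (2 ^ i)%N%:Z) <> 1%g.
  by move=> e; apply: neq1; rewrite e comm1g.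
have s2 : sparse (n + (2 ^ j)%N%:Z) <> 1%g.
  by move=> e; apply: neq1; rewrite e commg1.
(* Here n = 2^u - 2^i = 2^v - 2^j, which forces [u = i] and hence [n = 0]. *)
have [u eu] := sparse_neq1 s1; have [v ev] := sparse_neq1 s2.
have E : (2 ^ u + 2 ^ j = 2 ^ v + 2 ^ i)%N by lia.
by have [ui _] := pow2_diff_inj ij E; subst u; lia.
Qed.

Lemma generated_single j p : range k p -> Gen (single j p).
Proof.
move=> kp; have g0 := generated_single0 kp.
case: j => m.
  have -> : single m p = (single 0 p ^ (zshift ^+ m)^-1)%g.
    rewrite fiberwise_zshiftVJ; apply: eq_fiberwise => n.
    by rewrite subr_eq0.
  apply: generatedJ => //; apply: generatedV; apply: generatedX.
  exact: generated_t.
have -> : single (Negz m) p = (single 0 p ^ (zshift ^+ m.+1))%g.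
  rewrite fiberwise_zshiftJ; apply: eq_fiberwise => n.
  by rewrite NegzE addr_eq0.
by apply: generatedJ => //; apply: generatedX; exact: generated_t.
Qed.

Lemma generated_fin_fiberwise p : fin_fiberwise p -> Gen p.
Proof.
move=> [f [fk [m fm] ->]].
(* Induction on the length [l] of an interval starting at [- m] that contains the support; the last
   position is split off. *)
suff H (l : nat) : forall g : int -> bijection X, (forall n, range k (g n)) ->
    (forall n : int, g n <> 1%g -> - m%:Z <= n < - m%:Z + l%:Z) ->
    Gen (fiberwise g).
  apply: (H (m + m)%N f fk) => n fn.
  have : ~ (m <= `|n|)%N by move=> /fm.
  by move=> mn; lia.
elim: l => [|l IH] g gk gs.
  have -> : fiberwise g = 1%g; last exact: generated1.
    rewrite -fiberwise1; apply: eq_fiberwise => n.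
    by apply/eqP/contraT => /eqP/gs; lia.
pose j : int := - m%:Z + l%:Z.
have -> : fiberwise g =
    (fiberwise (fun n => if n == j then 1 else g n) * single j (g j))%g.
  rewrite fiberwiseM; apply: eq_fiberwise => n.
  by case: eqP => [->|_]; rewrite ?mul1g ?mulg1.
apply: generatedM; last exact: generated_single.
apply: IH => n; first by case: eqP => _ //; exact: range1.
case: eqP => // nj /gs; rewrite /j in nj *; lia.
Qed.

(** Distinct powers of 2 differ by at least the smaller one, so two distinct translates of [h] can
    overlap only at positions bounded in terms of [i] and [j]. *)
Lemma fin_fiberwise_comm_conj i j :
  fin_fiberwise [~ h ^ (zshift ^+ i), h ^ (zshift ^+ j)]%g.
Proof.
rewrite !fiberwise_zshiftJ fiberwiseR; eexists; split; [| |reflexivity].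
  by move=> n; apply: rangeR; exact: range_sparse.
have [ij|/eqP ij] := eqVneq i j.
  by exists 0%N => n _; rewrite ij commgg.
exists (2 * (i + j)).+1 => n large.
apply/eqP/contraT => /eqP neq1; exfalso.
have s1 : sparse (n + i%:Z) <> 1%g.
  by move=> e; apply: neq1; rewrite e comm1g.
have s2 : sparse (n + j%:Z) <> 1%g.
  by move=> e; apply: neq1; rewrite e commg1.
have [u eu] := sparse_neq1 s1; have [v ev] := sparse_neq1 s2.
have mono (a b : nat) : (a < b)%N -> (2 * 2 ^ a <= 2 ^ b)%N.
  by move=> ab; rewrite -expnS leq_exp2l.
have [uv|uv|uv] := ltngtP u v; last by subst u; lia.
- by have := mono _ _ uv; lia.
- by have := mono _ _ uv; lia.
Qed.

Lemma fin_fiberwise_commutator p : fin_fiberwise p ->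
  exists x y, [/\ fin_fiberwise x, fin_fiberwise y & p = [~ x, y]%g].
Proof.
move=> [f [fk [m fm] ->]].
(* The last clause keeps the supports of the two roots finite. *)
have ex n : exists ab : bijection X * bijection X,
    [/\ range k ab.1, range k ab.2, f n = [~ ab.1, ab.2]%g &
        f n = 1%g -> ab = (1%g, 1%g)].
  have [f1|f1] := pselect (f n = 1%g).
    by exists (1%g, 1%g); split=> //=; rewrite ?commg1 //; exact: range1.
  by have [a [b [? ? ?]]] := kcomm (fk n); exists (a, b).
have [w wP] := choice ex.
exists (fiberwise (fun n => (w n).1)), (fiberwise (fun n => (w n).2)); split.
- exists (fun n => (w n).1); split=> //; first by move=> n; case: (wP n).
  by exists m => n /fm fn; have [_ _ _ /(_ fn) ->] := wP n.
- exists (fun n => (w n).2); split=> //; first by move=> n; case: (wP n).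
  by exists m => n /fm fn; have [_ _ _ /(_ fn) ->] := wP n.
- by rewrite fiberwiseR; apply: eq_fiberwise => n; case: (wP n).
Qed.

(** A large shift makes the two finite supports disjoint. *)
Lemma fin_fiberwise_displaced x y : fin_fiberwise x -> fin_fiberwise y ->
  exists m, forall n, (m <= n)%N -> commute (x ^ (zshift ^+ n))%g y.
Proof.
move=> [f [fk [m fm] ->]] [g [gk [m' gm] ->]].
exists (m + m')%N => n large; rewrite fiberwise_zshiftJ /commute !fiberwiseM.
apply: eq_fiberwise => z.
have [zm|zm] := leqP m' `|z|; first by rewrite (gm z zm) mulg1 mul1g.
by rewrite fm ?mulg1 ?mul1g //; lia.
Qed.

End Wreath.

(** * Embedding of the given group at level 0 *)

Section BottomLevel.
Variable Gamma : groupType.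
Local Notation X := (Gamma * (nat -> int))%type.

(** The left regular action of [Gamma], carried by level 0, where the integer sequence vanishes. *)
Definition bottom_fun (g : Gamma) (x : X) : X :=
  if `[< level 0 x >] then ((g * x.1)%g, x.2) else x.

Fact bottom_funK g : cancel (bottom_fun g) (bottom_fun g^-1%g).
Proof.
move=> [y f]; rewrite /bottom_fun; have [lx|nx] := asboolP (level 0 (y, f)).
  by rewrite asboolT //= mulKg.
by rewrite asboolF.
Qed.

Fact bottom_funVK g : cancel (bottom_fun g^-1%g) (bottom_fun g).
Proof. by move=> x; rewrite -{1}[g]invgK bottom_funK. Qed.

Definition bottom (g : Gamma) : bijection X :=
  Bijection (@bottom_funK g) (@bottom_funVK g).

Lemma bottomM g g' : bottom (g * g')%g = (bottom g * bottom g')%g.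
Proof.
apply: bijection_ext => -[y f]; rewrite bijM /= /bottom_fun.
have [lx|nx] := asboolP (level 0 (y, f)); last by rewrite asboolF.
by rewrite asboolT //= mulgA.
Qed.

Lemma bottom_inj : injective bottom.
Proof.
move=> g g' /(congr1 (fun p : bijection X => p (1%g, fun=> 0))).
by rewrite /= /bottom_fun !asboolT // => -[]; rewrite !mulg1.
Qed.

Lemma tower_bottom g : tower (bottom g).
Proof. by exists 0%N => x nx; rewrite /= /bottom_fun asboolF. Qed.

End BottomLevel.

Theorem corollary1p4 (R : realType)
    (omega : set_system nat) (omegaU : UltraFilter omega)
    (omegaN : nonprincipal omega)
    (UU : set (normed_unitary R))
    (Gamma : groupType) (Gamma_countable : countable [set: Gamma]%classic) :
  exists G : groupType,
    [/\ embeds Gamma G, n_generated 3 G & uniformly_stable_linear G omega UU].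
Proof.
have /countable_injP[code code_inj] := Gamma_countable.
(* An enumeration of the image of [Gamma]; numbers that are not codes give the identity. *)
pose e n : bijection (Gamma * (nat -> int)) :=
  bottom (xget 1%g [set g | code g = n]).
have e_code g : e (code g) = bottom g.
  rewrite /e; congr bottom; case: xgetP => [g' _|/(_ g)] //= cg.
  by apply: code_inj; rewrite ?inE.
have [k [ke kM kV kcomm]] := countable_commutator_closure
  (@tower1 Gamma) (@towerM Gamma) (@towerV Gamma) (@tower_commutator Gamma)
  (fun n => tower_bottom _ : tower (e n)).
have kbottom g : range k (bottom g) by rewrite -e_code; exact: ke.
exists (generated_group (fiberwise (sparse k)) (zshift _)); split.
(* [Gamma] is placed in the factor of the restricted product at position 0. *)
- pose f g := generated_elt (generated_single kcomm 0 (kbottom g)).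
  have fM : {morph f : x y / (x * y)%g}.
    move=> x y; apply: val_inj; rewrite [RHS]valM /= bottomM /single fiberwiseM.
    by apply: eq_fiberwise => n; case: eqP; rewrite ?mulg1.
  pose F : {multiplicative Gamma ->
      generated_group (fiberwise (sparse k)) (zshift _)} :=
    HB.pack f (isMultiplicative.Build Gamma _ f fM).
  exists F => x y /(congr1 (@generated_val _ _ _)) /= xy; apply: bottom_inj.
  apply: bijection_ext => z.
  by have := congr1 (fun p : bijection _ => (p (0, z)).2) xy.
- exact: generated_group_3_generated.
- apply: (generated_group_stable omegaU omegaN (N := fin_fiberwise k)).
  + exact: fin_fiberwise1.
  + exact: fin_fiberwiseM.
  + exact: fin_fiberwiseV.
  + by move=> x g Nx Gg; exact: fin_fiberwiseJ.
  + by move=> x; exact: generated_fin_fiberwise.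
  + exact: fin_fiberwise_comm_conj.
  + exact: fin_fiberwise_commutator.
  + exact: fin_fiberwise_displaced.
Qed.
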